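(* Let $n\le 5$ be a positive integer. For every $w\in\mathrm{Trop}(\mathbb{S}_n^{\circ})$, the initial degeneration $\mathrm{in}_w\mathbb{S}_n^{\circ}$ is smooth and irreducible.
   Context: $\mathbf{k}$ is an algebraically closed field of characteristic $0$ (trivially valued), $[n]=\{0,1,\dots,n-1\}$, and $E(n)$ is the set of subsets $\lambda\subset[n]$ with $n-|\lambda|$ even. Spinor variety: $\mathbb{S}_n\subset\mathbb{P}(\mathbf{k}^{E(n)})$ is the Zariski closure of the set of points $[\mathrm{Pf}(X[[n]\setminus\lambda])]_{\lambda\in E(n)}$, where $X$ runs over skew-symmetric $n\times n$ matrices over $\mathbf{k}$ with rows and columns indexed by $[n]$, $X[\mu]$ is the principal submatrix on $\mu$, and $\mathrm{Pf}$ is the Pfaffian ($\mathrm{Pf}$ of the empty matrix is $1$). Let $I_n\subset\mathbf{k}[q_\lambda:\lambda\in E(n)]$ be the homogeneous ideal of $\mathbb{S}_n$, and $\mathbb{S}_n^{\circ}$ the intersection of $\mathbb{S}_n$ with the dense torus $T$ (all $q_\lambda\neq0$) of $\mathbb{P}(\mathbf{k}^{E(n)})$. For $w\in\mathbb{R}^{E(n)}/\mathbb{R}(1,\dots,1)$ and $f=\sum c_aq^a$, $\mathrm{in}_wf$ is the sum of the terms $c_aq^a$ with $c_a\ne 0$ and $\langle w,a\rangle$ minimal; $\mathrm{in}_wI_n$ is the ideal generated by all $\mathrm{in}_wf$, $f\in I_n$. $\mathrm{Trop}(\mathbb{S}_n^{\circ})$ is the set of $w$ such that $\mathrm{in}_wI_n$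 does not generate the unit ideal in the Laurent polynomial ring, and $\mathrm{in}_w\mathbb{S}_n^{\circ}=T\cap\mathrm{Proj}(\mathbf{k}[q_\lambda]/\mathrm{in}_wI_n)$. *)

(* Defs.v *)
From HB Require Import structures.
From mathcomp Require Import all_boot all_order all_algebra all_fingroup.
From mathcomp Require Import generic_quotient fraction.
From mathcomp Require Import boolp reals.
From mathcomp Require Import mpoly.

Set Implicit Arguments.
Unset Strict Implicit.
Unset Printing Implicit Defensive.

Import GRing.Theory Num.Theory.
Local Open Scope ring_scope.
Local Open Scope quotient_scope.

Record ideal (A : comPzRingType) := Ideal {
  ideal_mem :> A -> Prop;
  ideal0 : ideal_mem 0;
  idealD : forall x y, ideal_mem x -> ideal_mem y -> ideal_mem (x + y);
  idealM : forall a x, ideal_mem x -> ideal_mem (a * x) }.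

Section GeneratedIdeal.
Variables (A : comPzRingType) (G : A -> Prop).

Definition in_span (x : A) : Prop :=
  exists2 s : seq (A * A), (forall p, p \in s -> G p.2) &
    x = \sum_(p <- s) p.1 * p.2.

Lemma in_span0 : in_span 0.
Proof. by exists [::]; rewrite ?big_nil. Qed.

Lemma in_spanD x y : in_span x -> in_span y -> in_span (x + y).
Proof.
move=> [s Gs ->] [t Gt ->]; exists (s ++ t); last by rewrite big_cat.
by move=> p; rewrite mem_cat => /orP[/Gs|/Gt].
Qed.

Lemma in_spanM a x : in_span x -> in_span (a * x).
Proof.
move=> [s Gs ->]; exists [seq (a * p.1, p.2) | p <- s].
  by move=> p /mapP[q /Gs Gq ->].
by rewrite big_map mulr_sumr; apply: eq_bigr => p _; rewrite mulrA.
Qed.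

Definition gen_ideal : ideal A := Ideal in_span0 in_spanD in_spanM.

End GeneratedIdeal.

Section Contraction.
Variables (A B : comPzRingType) (f : {rmorphism A -> B}) (J : ideal B).

Lemma contr0 : J (f 0).
Proof. by rewrite rmorph0; apply: ideal0. Qed.

Lemma contrD x y : J (f x) -> J (f y) -> J (f (x + y)).
Proof. by rewrite rmorphD; apply: idealD. Qed.

Lemma contrM a x : J (f x) -> J (f (a * x)).
Proof. by rewrite rmorphM; apply: idealM. Qed.

Definition contraction : ideal A := @Ideal A (fun x => J (f x)) contr0 contrD contrM.

End Contraction.

(* The library quotient {ideal_quot _} only covers proper ideals; this one is
   defined for every ideal (and may be the zero ring). *)
Section Quotient.
Variables (A : comPzRingType) (J : ideal A).

Definition eqmod (x y : A) : bool := `[< J (x - y) >].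

Lemma idealN x : J x -> J (- x).
Proof. by move=> Jx; rewrite -mulN1r; apply: idealM. Qed.

Lemma eqmod_refl : reflexive eqmod.
Proof. by move=> x; apply/asboolP; rewrite subrr; apply: ideal0. Qed.

Lemma eqmod_sym : ssrbool.symmetric eqmod.
Proof.
by move=> x y; apply/asboolP/asboolP => /idealN; rewrite opprB.
Qed.

Lemma eqmod_trans : transitive eqmod.
Proof.
move=> y x z /asboolP Jxy /asboolP Jyz; apply/asboolP.
by rewrite -[x](subrK y) -addrA; apply: idealD.
Qed.

Canonical eqmod_equiv := EquivRel eqmod eqmod_refl eqmod_sym eqmod_trans.

Definition quotient_ring := {eq_quot eqmod_equiv}.

HB.instance Definition _ := Choice.on quotient_ring.
HB.instance Definition _ := EqQuotient.on quotient_ring.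

Local Notation Q := quotient_ring.

Lemma qeqP (x y : A) : reflect (J (x - y)) (x == y %[mod Q]).
Proof. by rewrite piE; apply: asboolP. Qed.

Definition qadd : Q -> Q -> Q := fun a b => \pi_Q (repr a + repr b).
Definition qopp : Q -> Q := fun a => \pi_Q (- repr a).
Definition qmul : Q -> Q -> Q := fun a b => \pi_Q (repr a * repr b).

Lemma reprJ x : J (repr (\pi_Q x) - x).
Proof. by apply/qeqP; rewrite reprK. Qed.

Lemma qaddE x y : qadd (\pi_Q x) (\pi_Q y) = \pi_Q (x + y).
Proof.
by apply/eqP/qeqP; rewrite opprD addrACA; apply: idealD; apply: reprJ.
Qed.

Lemma qoppE x : qopp (\pi_Q x) = \pi_Q (- x).
Proof. by apply/eqP/qeqP; rewrite -opprD; apply/idealN/reprJ. Qed.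

Lemma qmulE x y : qmul (\pi_Q x) (\pi_Q y) = \pi_Q (x * y).
Proof.
apply/eqP/qeqP; set x' := repr _; set y' := repr _.
have -> : x' * y' - x * y = x' * (y' - y) + y * (x' - x).
  by rewrite !mulrBr [y * x']mulrC [y * x]mulrC addrA subrK.
by apply: idealD; apply: idealM; apply: reprJ.
Qed.

Lemma qaddA : associative qadd.
Proof.
move=> a b c; rewrite -[a]reprK -[b]reprK -[c]reprK.
by rewrite !qaddE ?reprK addrA.
Qed.

Lemma qaddC : commutative qadd.
Proof. by move=> a b; rewrite -[a]reprK -[b]reprK !qaddE ?reprK addrC. Qed.

Lemma qadd0 : left_id (\pi_Q 0) qadd.
Proof. by move=> a; rewrite -[a]reprK qaddE add0r. Qed.

Lemma qaddN : left_inverse (\pi_Q 0) qopp qadd.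
Proof. by move=> a; rewrite -[a]reprK qoppE qaddE addNr. Qed.

HB.instance Definition _ := GRing.isZmodule.Build Q qaddA qaddC qadd0 qaddN.

Lemma qmulA : associative qmul.
Proof.
move=> a b c; rewrite -[a]reprK -[b]reprK -[c]reprK.
by rewrite !qmulE ?reprK mulrA.
Qed.

Lemma qmulC : commutative qmul.
Proof. by move=> a b; rewrite -[a]reprK -[b]reprK !qmulE ?reprK mulrC. Qed.

Lemma qmul1 : left_id (\pi_Q 1) qmul.
Proof. by move=> a; rewrite -[a]reprK qmulE mul1r. Qed.

Lemma qmulDl : left_distributive qmul qadd.
Proof.
move=> a b c; rewrite -[a]reprK -[b]reprK -[c]reprK.
by rewrite !(qaddE, qmulE) ?reprK mulrDl.
Qed.

HB.instance Definition _ :=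
  GRing.Zmodule_isComPzRing.Build Q qmulA qmulC qmul1 qmulDl.

Definition quot_map (x : A) : Q := \pi_Q x.

Lemma quot_map_zmod : zmod_morphism quot_map.
Proof.
by move=> x y; rewrite /quot_map -qaddE -qoppE.
Qed.

Lemma quot_map_monoid : monoid_morphism quot_map.
Proof. by split=> // x y; rewrite /quot_map -qmulE. Qed.

HB.instance Definition _ :=
  GRing.isZmodMorphism.Build A Q quot_map quot_map_zmod.
HB.instance Definition _ :=
  GRing.isMonoidMorphism.Build A Q quot_map quot_map_monoid.

End Quotient.

Section Spec.
Variable A : comPzRingType.

Record spec := Spec {
  prime_ideal :> ideal A;
  prime_proper : ~ prime_ideal 1;
  prime_mul : forall x y,
    prime_ideal (x * y) -> prime_ideal x \/ prime_ideal y }.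

Definition spec_closed (Z : spec -> Prop) : Prop :=
  exists S : A -> Prop, forall P : spec, Z P <-> (forall a, S a -> P a).

Definition spec_irreducible : Prop :=
  (exists P : spec, True) /\
  forall Z1 Z2 : spec -> Prop, spec_closed Z1 -> spec_closed Z2 ->
    (forall P, Z1 P \/ Z2 P) -> (forall P, Z1 P) \/ (forall P, Z2 P).

End Spec.

(* Spec A -> Spec K is smooth in the sense of EGA IV 17.3.1 (for a morphism of
   affine schemes): formally smooth, i.e. the infinitesimal lifting property
   along square-zero thickenings, and of finite presentation. *)
Section Smooth.
Variables (K : comNzRingType) (A : comPzRingType) (phi : {rmorphism K -> A}).

Definition formally_smooth : Prop :=
  forall (B C : comPzRingType) (pr : {rmorphism B -> C})
         (g : {rmorphism K -> B}) (h : {rmorphism A -> C}),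
    (forall c, exists b, pr b = c) ->
    (forall x y, pr x = 0 -> pr y = 0 -> x * y = 0) ->
    (forall c, h (phi c) = pr (g c)) ->
    exists l : {rmorphism A -> B},
      (forall c, l (phi c) = g c) /\ (forall a, pr (l a) = h a).

Definition finitely_presented : Prop :=
  exists (m : nat) (ev : {rmorphism {mpoly K[m]} -> A}) (F : seq {mpoly K[m]}),
    [/\ forall c, ev c%:MP = phi c,
        forall a, exists p, ev p = a &
        forall p, ev p = 0 <-> gen_ideal (fun f => f \in F) p].

Definition smooth : Prop := formally_smooth /\ finitely_presented.

End Smooth.

(* For a finite type E, the variable q_i (i : E) of the polynomial ring
   k[q_i : i in E] is 'X_(enum_rank i) in {mpoly k[#|E|]}. *)
Section Torus.
Variables (k : fieldType) (E : finType).

Local Notation S := {mpoly k[#|E|]}.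

Definition eval_at (x : E -> k) (f : S) : k := f.@[fun i => x (enum_val i)].

Definition homogeneous (f : S) : Prop := exists d : nat, f \is d.-homog.

Definition laurent_pred : {pred {fraction S}} :=
  fun x => `[< exists (f : S) (a : 'X_{1..#|E|}),
                 x = (tofrac f) / (tofrac 'X_[a]) >].

Lemma tofracX_neq0 (a : 'X_{1..#|E|}) : tofrac ('X_[a] : S) != 0.
Proof. by rewrite tofrac_eq0 -msupp_eq0 msuppX. Qed.

Lemma laurent_subring : subring_closed laurent_pred.
Proof.
split.
- apply/asboolP; exists 1, 0%MM; rewrite mpolyX0 rmorph1 divr1 //.
- move=> _ _ /asboolP[f [a ->]] /asboolP[g [b ->]]; apply/asboolP.
  exists (f * 'X_[b] - g * 'X_[a]), (a + b)%MM.
  rewrite mpolyXD !(rmorphM, rmorphB) /= mulrBl -!mulf_div.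
  by rewrite divff ?tofracX_neq0 // mulr1 [_ / _ * (_ / _)]mulf_div
     [tofrac 'X_[a] * _]mulrC -mulf_div divff ?tofracX_neq0 // mulr1.
- move=> _ _ /asboolP[f [a ->]] /asboolP[g [b ->]]; apply/asboolP.
  by exists (f * g), (a + b)%MM; rewrite mpolyXD !rmorphM mulf_div.
Qed.

HB.instance Definition _ :=
  GRing.isSubringClosed.Build {fraction S} laurent_pred laurent_subring.

Definition laurent := {x : {fraction S} | x \in laurent_pred}.
HB.instance Definition _ := SubChoice.on laurent.
HB.instance Definition _ := [SubChoice_isSubComNzRing of laurent by <:].


Lemma poly_to_laurent_proof (f : S) : tofrac f \in laurent_pred.
Proof.
by apply/asboolP; exists f, 0%MM; rewrite mpolyX0 rmorph1 divr1.
Qed.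

Definition poly_to_laurent (f : S) : laurent :=
  exist (fun x => x \in laurent_pred) _ (poly_to_laurent_proof f).

Definition deg0_pred : {pred laurent} :=
  fun x => `[< exists (f : S) (a : 'X_{1..#|E|}),
                 f \is (mdeg a).-homog /\
                 val x = (tofrac f) / (tofrac 'X_[a]) >].

Lemma deg0_subring : subring_closed deg0_pred.
Proof.
split.
- apply/asboolP; exists 1, 0%MM; split; first by rewrite mdeg0 dhomog1.
  by rewrite mpolyX0 rmorph1 divr1 //.
- move=> x y /asboolP[f [a [fa xE]]] /asboolP[g [b [gb yE]]]; apply/asboolP.
  exists (f * 'X_[b] - g * 'X_[a]), (a + b)%MM; split.
    rewrite mdegD; apply: rpredB; first by apply: dhomogM; rewrite ?dhomogX.
    by rewrite addnC; apply: dhomogM; rewrite ?dhomogX.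
  rewrite rmorphB /= xE yE.
  rewrite mpolyXD !(rmorphM, rmorphB) /= mulrBl -!mulf_div.
  by rewrite divff ?tofracX_neq0 // mulr1 [_ / _ * (_ / _)]mulf_div
     [tofrac 'X_[a] * _]mulrC -mulf_div divff ?tofracX_neq0 // mulr1.
- move=> x y /asboolP[f [a [fa xE]]] /asboolP[g [b [gb yE]]]; apply/asboolP.
  exists (f * g), (a + b)%MM; split; first by rewrite mdegD dhomogM.
  by rewrite rmorphM /= xE yE mpolyXD !rmorphM mulf_div.
Qed.

HB.instance Definition _ :=
  GRing.isSubringClosed.Build laurent deg0_pred deg0_subring.

(* The coordinate ring of the dense torus T of P(k^E). *)
Definition torus_ring := {x : laurent | x \in deg0_pred}.
HB.instance Definition _ := SubChoice.on torus_ring.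
HB.instance Definition _ := [SubChoice_isSubComNzRing of torus_ring by <:].

Lemma torus_const_proof (c : k) : poly_to_laurent c%:MP \in deg0_pred.
Proof.
apply/asboolP; exists c%:MP, 0%MM; split.
  by rewrite mdeg0 -[c%:MP]mulr1 mul_mpolyC rpredZ // dhomog1.
by rewrite mpolyX0 rmorph1 divr1.
Qed.

Definition torus_const (c : k) : torus_ring :=
  exist (fun x => x \in deg0_pred) _ (torus_const_proof c).

Lemma torus_const_zmod : zmod_morphism torus_const.
Proof. by move=> a b; do 2 apply: val_inj; rewrite /= !rmorphB. Qed.

Lemma torus_const_monoid : monoid_morphism torus_const.
Proof.
by split=> [|a b]; do 2 apply: val_inj; rewrite /= ?rmorph1 ?rmorphM.
Qed.

HB.instance Definition _ :=
  GRing.isZmodMorphism.Build k torus_ring torus_const torus_const_zmod.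
HB.instance Definition _ :=
  GRing.isMonoidMorphism.Build k torus_ring torus_const torus_const_monoid.

Definition laurent_ideal (J : ideal S) : ideal laurent :=
  gen_ideal (fun x => exists2 f, J f & x = poly_to_laurent f).

(* For J homogeneous, T meets Proj(S/J) in the affine open subset where
   \prod_i q_i is invertible, whose coordinate ring is the degree-0 part of
   the Laurent ring modulo J; torus_scheme J is this ring. *)
Definition torus_scheme (J : ideal S) : comPzRingType :=
  quotient_ring (contraction (val : torus_ring -> laurent) (laurent_ideal J)).

Definition torus_structure (J : ideal S) : {rmorphism k -> torus_scheme J} :=
  quot_map _ \o torus_const.

Definition proj_closure (Y : (E -> k) -> Prop) (x : E -> k) : Prop :=
  (exists i, x i != 0) /\
  forall f : S, homogeneous f ->
    (forall y, Y y -> eval_at y f = 0) -> eval_at x f = 0.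

Definition homogeneous_ideal (X : (E -> k) -> Prop) : ideal S :=
  gen_ideal (fun f : S =>
    homogeneous f /\ forall x, X x -> eval_at x f = 0).

(* w represents a class in R^E / R(1, ..., 1); for a homogeneous ideal I,
   initial_ideal w I and in_trop w I do not depend on the representative. *)
Section Initial.
Variables (R : realType) (w : E -> R).

Definition weight (a : 'X_{1..#|E|}) : R :=
  \sum_(i : E) w i * (a (enum_rank i))%:R.

Definition initial_form (f : S) : S :=
  \sum_(a <- msupp f | all (fun b => weight a <= weight b) (msupp f))
    f@_a *: 'X_[a].

Definition initial_ideal (I : ideal S) : ideal S :=
  gen_ideal (fun g => exists2 f, I f & g = initial_form f).

Definition in_trop (I : ideal S) : Prop :=
  ~ laurent_ideal (initial_ideal I) 1.

End Initial.

End Torus.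

(* Meaningful for m even, A skew-symmetric and k of characteristic 0. The pairs p
   in the product are the (2i, 2i+1) with i < m/2. *)
Definition Pfaffian (k : fieldType) (m : nat) (A : 'M[k]_m) : k :=
  (2 ^ m./2 * (m./2)`!)%:R^-1 *
  \sum_(s : 'S_m) (-1) ^+ s *
     \prod_(p : 'I_m * 'I_m | ~~ odd p.1 && (p.2 == p.1.+1 :> nat))
        A (s p.1) (s p.2).

Section Spinor.
Variables (k : fieldType) (n : nat).

Definition spinor_index := {lam : {set 'I_n} | ~~ odd (n - #|lam|)}.
HB.instance Definition _ := Finite.on spinor_index.

Definition principal_submatrix (X : 'M[k]_n) (mu : {set 'I_n}) : 'M[k]_#|mu| :=
  \matrix_(i, j) X (enum_val i) (enum_val j).

Definition pfaffian_point (X : 'M[k]_n) : spinor_index -> k :=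
  fun lam => Pfaffian (principal_submatrix X (~: val lam)).

Definition spinor_variety : (spinor_index -> k) -> Prop :=
  proj_closure (fun y => exists2 X : 'M[k]_n, X^T = - X & y = pfaffian_point X).

Definition spinor_ideal := homogeneous_ideal spinor_variety.

End Spinor.

(* Main.v *)
(* Suppose that 11 of the coordinates q_b are free on the spinor variety and that each of
   the other five satisfies a relation q^a q_d = g_d with a and g_d in the free coordinates,
   where no monomial of g_d has smaller weight than q^a q_d. Substituting g_d / q^a for q_d
   kills I_n, so by comparing the terms of lowest weight the substitution q_d := in_w(g_d) / q^a
   kills in_w I_n; conversely q^a q_d - in_w(g_d) is an initial form of an element of I_n.
   Hence in_w S_n is an open subscheme of a torus, which is smooth and irreducible.

   For n = 5 the ideal contains ten quadrics, each with four monomials on disjoint pairs of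
   variables. The monomials are the edges of the folded 5-cube on the 16 coordinates, and the
   quadrics are given by a direction and a side. Call an edge bad if it is not of minimal weight
   in its quadric. If a vertex v has only good edges, its five quadrics give the relations. If it
   has a single bad edge, we solve that quadric for the variable of another, good, edge and
   substitute. Some vertex has at most one bad edge: take v with the fewest bad edges and assume
   that directions i and j are bad. As the minimum is attained twice in each quadric, there is a
   vertex u, differing from v in two further directions k and l, whose edges i and j are
   good, and one checks that u is good at k (resp. l) if v is good at l (resp. k); so u has
   fewer bad edges than v. *)
From HB Require Import structures.
Require Import Defs.
From mathcomp Require Import all_boot all_order all_algebra all_fingroup.
From mathcomp Require Import generic_quotient fraction.
From mathcomp Require Import boolp reals.
From mathcomp Require Import ring lra.
From mathcomp Require Import mpoly.

Set Implicit Arguments.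
Unset Strict Implicit.
Unset Printing Implicit Defensive.

Import Order.TTheory GRing.Theory Num.Theory.
Local Open Scope ring_scope.

(** * Maps out of polynomial, Laurent and torus rings *)

Section PolynomialMaps.
Variables (k : comNzRingType) (n : nat) (C : comPzRingType).
Implicit Types f g : {rmorphism {mpoly k[n]} -> C}.

Lemma mpoly_rmorphE f (p : {mpoly k[n]}) :
  f p = \sum_(m <- msupp p) f (p@_m)%:MP * \prod_i f 'X_i ^+ m i.
Proof.
rewrite {1}[p]mpolyE rmorph_sum; apply: eq_bigr => m _.
rewrite -mul_mpolyC rmorphM mpolyXE_id rmorph_prod; congr (_ * _).
by apply: eq_bigr => i _; rewrite rmorphXn.
Qed.

Lemma mpoly_rmorph_eq f g (p : {mpoly k[n]}) :
    (forall c, f c%:MP = g c%:MP) ->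
    (forall m i, m \in msupp p -> m i != 0%N -> f 'X_i = g 'X_i) ->
  f p = g p.
Proof.
move=> fgC fgX; rewrite (mpoly_rmorphE f) (mpoly_rmorphE g) big_seq [RHS]big_seq.
apply: eq_bigr => m pm; rewrite fgC; congr (_ * _).
apply: eq_bigr => i _; have [->|mi0] := eqVneq (m i) 0%N; first by rewrite !expr0.
by rewrite (fgX m).
Qed.

(* [mmap] needs a nonzero target, so the zero ring is treated apart. *)
Lemma mpoly_rmorph_exists (g : {rmorphism k -> C}) (u : 'I_n -> C) :
  exists f, (forall c, f c%:MP = g c) /\ forall i, f 'X_i = u i.
Proof.
have [C0|/eqP C1] := pselect ((1 : C) = 0).
  have all0 (x y : C) : x = y by rewrite -[x]mul1r -[y]mul1r C0 !mul0r.
  pose z (_ : {mpoly k[n]}) : C := 0.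
  have zB : zmod_morphism z by move=> x y; rewrite /z subr0.
  have zM : monoid_morphism z by split=> [|x y]; apply: all0.
  pose zA := GRing.isZmodMorphism.Build _ _ z zB.
  pose zR := GRing.isMonoidMorphism.Build _ _ z zM.
  pose f : {rmorphism {mpoly k[n]} -> C} := HB.pack z zA zR.
  by exists f; split=> *; apply: all0.
pose nz := GRing.PzSemiRing_isNonZero.Build C C1.
pose C' : comNzRingType := HB.pack (GRing.ComPzRing.sort C) nz.
pose g' : {rmorphism k -> C'} := g.
pose f : {rmorphism {mpoly k[n]} -> C'} := mmap g' (u : 'I_n -> C').
exists f; split=> [c|i]; first by rewrite /f /= mmapC.
by rewrite /f /= mmapX mmap1U.
Qed.

End PolynomialMaps.

(** No coefficient of [p] is lost when it is read as a polynomial in its last variable, so [muni] is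
    injective; this drives the induction on the number of variables below. *)
Lemma coef_muni (R : comNzRingType) (n : nat) (p : {mpoly R[n.+1]})
    (m : 'X_{1..n.+1}) :
  (muni p)`_(m ord_max)@_[multinom m (widen_ord (leqnSn n) i) | i < n] = p@_m.
Proof.
rewrite muniE coef_sum raddf_sum /= [in RHS](mpolyE p) raddf_sum /=.
apply: eq_bigr => m' _; rewrite coefZ coefXn mcoeffZ mcoeffX.
have [->|m'm] := eqVneq m' m; first by rewrite eqxx mulr1 mcoeffZ mcoeffX eqxx.
have [mm|_] := eqVneq; last by rewrite !mulr0 mcoeff0.
rewrite !mulr1 mcoeffZ mcoeffX; case: eqP => // /mnmP mw; rewrite mulr0.
case/eqP: m'm; apply/mnmP => i; case: (unliftP ord_max i) => [j ->|-> //].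
have -> : lift ord_max j = widen_ord (leqnSn n) j.
  by apply: val_inj; rewrite /= /bump leqNgt ltn_ord.
by have := mw j; rewrite !mnmE.
Qed.

(** Once all variables but the last are specialized, [p] becomes a univariate polynomial that
    vanishes identically, hence zero; so every coefficient of [muni p] vanishes everywhere, and
    induction applies. *)
Lemma mpoly_zero_of_vanishing (k : closedFieldType) (n : nat) (p : {mpoly k[n]}) :
  (forall c, p.@[c] = 0) -> p = 0.
Proof.
elim: n p => [|n IHn] p p0.
  by have := p0 (fun=> 0); rewrite [p]nvar0_mpolyC mevalC => ->.
suff q0 : muni p = 0.
  by apply/mpolyP => m; rewrite -coef_muni q0 coef0 !mcoeff0.
apply/polyP => j; rewrite coef0; apply: IHn => c.
pose q := map_poly (meval c) (muni p); suff q0 : q = 0.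
  by have := coef_map (meval c) (muni p) j; rewrite -/q q0 coef0.
have qx x : q.[x] = 0.
  pose c' (i : 'I_n.+1) := if unlift ord_max i is Some i' then c i' else x.
  rewrite -[RHS](p0 c') /q.
  pose f : {rmorphism {mpoly k[n.+1]} -> k} := horner_eval x \o map_poly (meval c) \o (@muni n k).
  pose g : {rmorphism {mpoly k[n.+1]} -> k} := meval c'.
  suff : f p = g p by [].
  apply: mpoly_rmorph_eq => [a|m i _ _].
    rewrite /f /g /= /horner_eval muniC map_polyC hornerC mevalC; apply: mevalC.
  rewrite /f /g /= /horner_eval mevalXU /muni mmapX mmap1U.
  case: splitP => i' /= ii'.
    rewrite map_polyC hornerC /= mevalXU /c'.
    have -> : i = lift ord_max i'.
      by apply: val_inj; rewrite /= /bump leqNgt ltn_ord.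
    by rewrite liftK.
  rewrite map_polyX hornerX /c'; case: unliftP => // i'' ie.
  by move: ii'; rewrite ie /= /bump leqNgt ltn_ord ord1 addn0 /= => e; case/eqP: (ltn_eqF (ltn_ord i'')).
apply: contraTeq isT => qN0; have [q1|q1] := leqP (size q) 1.
  by move: qN0 (qx 0); rewrite (size1_polyC q1) polyC_eq0 hornerC => /eqP.
(* A nonconstant [q] takes the value -1, because [q + 1] has a root; this contradicts [qx]. *)
have [x] : exists x, root (q + 1) x.
  by apply/closed_rootP; rewrite size_polyDl ?size_poly1 // neq_ltn q1 orbT.
by rewrite rootE hornerD qx hornerC add0r oner_eq0.
Qed.

(** * Quotient rings and irreducible spectra *)

Section QuotientMaps.
Variables (A C : comPzRingType) (J : ideal A).

Lemma quot_map_eq0 x : quot_map J x = 0 <-> J x.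
Proof.
have -> : (quot_map J x = 0) <-> (\pi_(quotient_ring J) x = \pi_(quotient_ring J) 0)%qT by [].
by rewrite -[J x]/(J x); split=> [/eqP/qeqP|Jx]; [rewrite subr0|apply/eqP/qeqP; rewrite subr0].
Qed.

Lemma quot_map_eq x y : J (x - y) -> quot_map J x = quot_map J y.
Proof.
by move=> Jxy; apply/eqP; rewrite -subr_eq0 -rmorphB; apply/eqP/quot_map_eq0.
Qed.

Lemma quot_map_surj (a : quotient_ring J) : exists x, a = quot_map J x.
Proof. by exists (repr a); rewrite /quot_map reprK. Qed.

Lemma quot_lift (phi : {rmorphism A -> C}) :
    (forall x, J x -> phi x = 0) ->
  exists l : {rmorphism quotient_ring J -> C},
    forall x, l (quot_map J x) = phi x.
Proof.
move=> phiJ; pose l (a : quotient_ring J) := phi (repr a).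
have lE x : l (quot_map J x) = phi x.
  by apply/eqP; rewrite -subr_eq0 -rmorphB; apply/eqP/phiJ/reprJ.
have lB : zmod_morphism l.
  move=> a b; have [x ->] := quot_map_surj a; have [y ->] := quot_map_surj b.
  by rewrite -rmorphB !lE rmorphB.
have lM : monoid_morphism l.
  split=> [|a b]; first by rewrite -(rmorph1 (quot_map J)) lE rmorph1.
  have [x ->] := quot_map_surj a; have [y ->] := quot_map_surj b.
  by rewrite -rmorphM !lE rmorphM.
pose lA := GRing.isZmodMorphism.Build _ _ l lB.
pose lR := GRing.isMonoidMorphism.Build _ _ l lM.
pose lRM : {rmorphism quotient_ring J -> C} := HB.pack l lA lR.
by exists lRM.
Qed.

End QuotientMaps.

(** The zero ideal of the quotient is prime and lies in every other prime, so a closed set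
    containing this generic point is the whole spectrum. *)
Lemma prime_quotient_irreducible (A : comPzRingType) (J : ideal A) :
    ~ J 1 -> (forall x y, J (x * y) -> J x \/ J y) ->
  spec_irreducible (quotient_ring J).
Proof.
move=> J1 Jprime; pose Q := quotient_ring J.
pose zero (a : Q) := a = 0.
have zeroD a b : zero a -> zero b -> zero (a + b) by move=> -> ->; apply: addr0.
have zeroM a b : zero b -> zero (a * b) by move=> ->; apply: mulr0.
pose Z := Ideal (erefl : zero 0) zeroD zeroM.
have Z1 : ~ Z 1 by rewrite -(rmorph1 (quot_map J)) => /quot_map_eq0.
have Zprime a b : Z (a * b) -> Z a \/ Z b.
  have [x ->] := quot_map_surj a; have [y ->] := quot_map_surj b.
  by rewrite -rmorphM => /quot_map_eq0/Jprime[]/quot_map_eq0; [left|right].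
pose P := Spec Z1 Zprime.
have closedP (W : spec Q -> Prop) : spec_closed W -> W P -> forall P', W P'.
  move=> [S WS] /WS SZ P'; apply/WS => a /SZ ->; apply: ideal0.
split=> [|W1 W2 cW1 cW2 W12]; first by exists P.
by case: (W12 P) => [WP|WP]; [left|right]; apply: closedP.
Qed.

(** The kernel of a map into a domain is prime, and so is its contraction. *)
Lemma prime_contraction_irreducible (A B : comPzRingType) (K : idomainType)
    (f : {rmorphism A -> B}) (J : ideal B) (Psi : {rmorphism B -> K}) :
  (forall x, J x <-> Psi x = 0) -> ~ J 1 ->
  spec_irreducible (quotient_ring (contraction f J)).
Proof.
move=> JPsi J1; apply: prime_quotient_irreducible; rewrite /= ?rmorph1 // => x y.
by rewrite rmorphM !JPsi rmorphM => /eqP; rewrite mulf_eq0 => /orP[]/eqP; [left|right].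
Qed.

(** * Universal property of the Laurent ring *)

Section LaurentMaps.
Variables (k : fieldType) (E : finType).
Local Notation S := {mpoly k[#|E|]}.
Local Notation L := (laurent k E).
Local Notation P := (@poly_to_laurent k E).
Local Notation var i := ('X_(enum_rank i) : S).

Lemma poly_to_laurent_zmod : zmod_morphism P.
Proof. by move=> f g; apply: val_inj; rewrite /= !rmorphB. Qed.

Lemma poly_to_laurent_monoid : monoid_morphism P.
Proof. by split=> [|f g]; apply: val_inj; rewrite /= ?rmorph1 ?rmorphM. Qed.

HB.instance Definition _ :=
  GRing.isZmodMorphism.Build S L P poly_to_laurent_zmod.
HB.instance Definition _ :=
  GRing.isMonoidMorphism.Build S L P poly_to_laurent_monoid.

Lemma poly_to_laurent_inj : injective P.
Proof. by move=> f g /(congr1 val)/= /eqP; rewrite tofrac_eq => /eqP. Qed.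

Lemma monomial_inv_proof (a : 'X_{1..#|E|}) :
  (tofrac ('X_[a] : S))^-1 \in @laurent_pred k E.
Proof. by apply/asboolP; exists 1, a; rewrite rmorph1 div1r. Qed.

Definition monomial_inv (a : 'X_{1..#|E|}) : L :=
  exist (fun x => x \in @laurent_pred k E) _ (monomial_inv_proof a).

Lemma monomial_invK a : P 'X_[a] * monomial_inv a = 1.
Proof. by apply: val_inj; rewrite /= divff ?tofracX_neq0. Qed.

Lemma laurent_fraction (x : L) :
  exists (f : S) (a : 'X_{1..#|E|}), x = P f * monomial_inv a.
Proof.
have /asboolP[f [a xE]] := valP x.
by exists f, a; apply: val_inj.
Qed.

Lemma poly_rmorph_eq (C : comPzRingType) (f g : {rmorphism S -> C}) :
    (forall c, f c%:MP = g c%:MP) -> (forall i, f (var i) = g (var i)) ->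
  f =1 g.
Proof.
move=> fgC fgX p; apply: mpoly_rmorph_eq => // m j _ _.
by have := fgX (enum_val j); rewrite enum_valK.
Qed.

Lemma poly_rmorph_exists (C : comPzRingType) (g : {rmorphism k -> C})
    (u : E -> C) :
  exists f : {rmorphism S -> C},
    (forall c, f c%:MP = g c) /\ forall i, f (var i) = u i.
Proof.
have [f [fC fX]] := mpoly_rmorph_exists g (fun j : 'I_#|E| => u (enum_val j)).
by exists f; split=> // i; rewrite fX enum_rankK.
Qed.

Section Lift.
Variables (C : comPzRingType) (g : {rmorphism k -> C}) (u v : E -> C).
Hypothesis uv1 : forall i, u i * v i = 1.

(** The Laurent ring is built inside the fraction field, so its universal property has to be
    derived: p / q^a is sent to f(p) f'(q^a), where [f] evaluates at [u] and [f'] at the inverses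
    [v]. *)
Lemma laurent_lift : exists phi : {rmorphism L -> C},
  (forall c, phi (P c%:MP) = g c) /\ forall i, phi (P (var i)) = u i.
Proof.
have [f [fC fX]] := poly_rmorph_exists g u.
have [f' [f'C f'X]] := poly_rmorph_exists g v.
have ff' a : f 'X_[a] * f' 'X_[a] = 1.
  rewrite mpolyXE_id !rmorph_prod -big_split big1 //= => j _.
  by rewrite !rmorphXn -exprMn -(enum_valK j) fX f'X uv1 expr1n.
have exP (x : L) : exists p : S * 'X_{1..#|E|}, x = P p.1 * monomial_inv p.2.
  by have [p [a ->]] := laurent_fraction x; exists (p, a).
pose rep x := sval (cid (exP x)).
have repE x : x = P (rep x).1 * monomial_inv (rep x).2 := svalP (cid (exP x)).
pose phi x := f (rep x).1 * f' 'X_[(rep x).2].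
have phiE p a : phi (P p * monomial_inv a) = f p * f' 'X_[a].
  set x : L := P p * monomial_inv a; rewrite /phi.
  set p' := (rep x).1; set a' := (rep x).2.
  (* Two fractions of the same element agree after cross-multiplication, so the value does not
     depend on the representative chosen by [rep]. *)
  have e : p * 'X_[a'] = p' * 'X_[a].
    apply: poly_to_laurent_inj; rewrite !rmorphM /=.
    have invK b y : y * monomial_inv b * P 'X_[b] = y.
      by rewrite -mulrA [_ * P _]mulrC monomial_invK mulr1.
    transitivity (x * P 'X_[a] * P 'X_[a']); first by rewrite /x invK.
    by rewrite [x]repE mulrAC invK.
  have {}e : f p * f 'X_[a'] = f p' * f 'X_[a] by rewrite -!rmorphM e.
  symmetry; transitivity (f p * f 'X_[a'] * (f' 'X_[a] * f' 'X_[a'])).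
    by rewrite mulrACA ff' mulr1.
  by rewrite e [f' _ * _]mulrC mulrACA ff' mulr1.
have phiB : zmod_morphism phi.
  move=> x y; have [p [a ->]] := laurent_fraction x.
  have [q [b ->]] := laurent_fraction y.
  have -> : P p * monomial_inv a - P q * monomial_inv b =
      P (p * 'X_[b] - q * 'X_[a]) * monomial_inv (a + b)%MM.
    apply: val_inj; rewrite /= mpolyXD !(rmorphB, rmorphM) /= mulrBl -!mulf_div.
    rewrite divff ?tofracX_neq0 // mulr1 mulf_div [tofrac 'X_[a] * _]mulrC -mulf_div.
    by rewrite divff ?tofracX_neq0 // mulr1.
  rewrite !phiE mpolyXD !(rmorphB, rmorphM) mulrBl; congr (_ - _).
    by rewrite mulrACA ff' mulr1.
  by rewrite [f' 'X_[a] * _]mulrC mulrACA ff' mulr1.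
have phiM : monoid_morphism phi.
  split=> [|x y].
    have -> : 1 = P 'X_[0] * monomial_inv 0%MM by rewrite monomial_invK.
    by rewrite phiE ff'.
  have [p [a ->]] := laurent_fraction x; have [q [b ->]] := laurent_fraction y.
  have -> : P p * monomial_inv a * (P q * monomial_inv b) =
      P (p * q) * monomial_inv (a + b)%MM.
    by apply: val_inj; rewrite /= mpolyXD !rmorphM invfM mulrACA.
  by rewrite !phiE mpolyXD !rmorphM mulrACA.
pose phiA := GRing.isZmodMorphism.Build _ _ phi phiB.
pose phiR := GRing.isMonoidMorphism.Build _ _ phi phiM.
have phiP p : phi (P p) = f p.
  have -> : P p = P p * monomial_inv 0%MM.
    by apply: val_inj; rewrite /= mpolyX0 rmorph1 divr1.
  by rewrite phiE mpolyX0 rmorph1 mulr1.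
pose Phi : {rmorphism L -> C} := HB.pack phi phiA phiR.
by exists Phi; split=> [c|i] /=; rewrite phiP.
Qed.

End Lift.

End LaurentMaps.

Arguments monomial_inv {k E} a.

(** * Affine coordinates on the dense torus *)

Section TorusRing.
Variables (k : fieldType) (E : finType) (i0 : E).
Local Notation S := {mpoly k[#|E|]}.
Local Notation L := (laurent k E).
Local Notation T := (torus_ring k E).
Local Notation P := (@poly_to_laurent k E).
Local Notation var i := ('X_(enum_rank i) : S).

Lemma monomialE (m : 'X_{1..#|E|}) :
  'X_[m] = \prod_(i : E) var i ^+ m (enum_rank i).
Proof. by rewrite mpolyXE_id (reindex enum_rank) //; apply/onW_bij/enum_rank_bij. Qed.

Lemma coord_ratio_proof i j : P (var i) * monomial_inv U_(enum_rank j)%MM \in @deg0_pred k E.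
Proof.
apply/asboolP; exists (var i), U_(enum_rank j)%MM; split=> //.
by rewrite dhomogX /= !mdeg1.
Qed.

Definition coord_ratio i j : T :=
  exist (fun x => x \in @deg0_pred k E) _ (coord_ratio_proof i j).

Lemma val_coord_ratio i j : val (coord_ratio i j) = P (var i) * monomial_inv U_(enum_rank j)%MM.
Proof. by []. Qed.

Lemma coord_ratioK i j : coord_ratio i j * coord_ratio j i = 1.
Proof.
apply: val_inj; rewrite rmorphM /= [X in _ * X]mulrC mulrACA monomial_invK.
by rewrite mul1r mulrC monomial_invK.
Qed.

Lemma coord_ratio_id i : coord_ratio i i = 1.
Proof. by apply: val_inj; rewrite val_coord_ratio monomial_invK. Qed.

(** Passage to the affine chart q_i0 = 1: q_i is replaced by q_i / q_i0, and a form of degree d by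
    its quotient by q_i0^d. *)
Definition dehomogenize : S -> T :=
  mmap (@torus_const k E) (fun j => coord_ratio (enum_val j) i0).
HB.instance Definition _ := GRing.RMorphism.on dehomogenize.

Lemma dehomogenizeC c : dehomogenize c%:MP = torus_const E c.
Proof. exact: mmapC. Qed.

Lemma dehomogenizeX i : dehomogenize (var i) = coord_ratio i i0.
Proof. by rewrite /dehomogenize mmapX mmap1U enum_rankK. Qed.

Lemma dehomogenize_monomial m :
  val (dehomogenize 'X_[m]) = P 'X_[m] * monomial_inv U_(enum_rank i0)%MM ^+ mdeg m.
Proof.
pose f : {rmorphism S -> L} := (val : T -> L) \o dehomogenize.
have fX i : f (var i) = P (var i) * monomial_inv U_(enum_rank i0)%MM.
  by rewrite /f /= dehomogenizeX.
have : val (dehomogenize 'X_[m]) = f 'X_[m] by [].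
move: f fX => f fX ->; rewrite monomialE (rmorph_prod f) (rmorph_prod P).
rewrite mdegE (reindex (@enum_rank E)) /=; last exact/onW_bij/enum_rank_bij.
rewrite -prodrXr -big_split /=; apply: eq_bigr => i _.
by rewrite (rmorphXn f) (rmorphXn P) fX exprMn.
Qed.

Lemma dehomogenize_homog (f : S) d : f \is d.-homog ->
  val (dehomogenize f) = P f * monomial_inv U_(enum_rank i0)%MM ^+ d.
Proof.
move=> /dhomogP fd; pose h : {rmorphism S -> L} := (val : T -> L) \o dehomogenize.
have hC c : h c%:MP = P c%:MP by rewrite /h /= dehomogenizeC.
have hX m : h 'X_[m] = P 'X_[m] * monomial_inv U_(enum_rank i0)%MM ^+ mdeg m.
  exact: dehomogenize_monomial.
have -> : val (dehomogenize f) = h f by [].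
move: h hC hX => h hC hX; rewrite [f]mpolyE (rmorph_sum h) (rmorph_sum P) mulr_suml.
rewrite big_seq [RHS]big_seq; apply: eq_bigr => m /fd <-.
by rewrite -mul_mpolyC (rmorphM h) (rmorphM P) hC hX mulrA.
Qed.

Lemma dehomogenize_unit (m : 'X_{1..#|E|}) : exists y, dehomogenize 'X_[m] * y = 1.
Proof.
exists (\prod_i coord_ratio i0 i ^+ m (enum_rank i)).
rewrite monomialE rmorph_prod -big_split big1 //= => i _.
by rewrite rmorphXn /= dehomogenizeX -exprMn coord_ratioK expr1n.
Qed.

(** Numerator and denominator have the same degree, so dehomogenizing divides both by the same power
    of q_i0. *)
Lemma torus_fraction (x : T) : exists (f : S) (a : 'X_{1..#|E|}),
  val x = P f * monomial_inv a /\ x * dehomogenize 'X_[a] = dehomogenize f.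
Proof.
have /asboolP[f [a [fa xE]]] := valP x; exists f, a.
have xE' : val x = P f * monomial_inv a by apply: val_inj.
split=> //; apply: val_inj.
rewrite -[LHS]/(val x * val (dehomogenize 'X_[a])) dehomogenize_monomial (dehomogenize_homog fa) xE'.
by rewrite mulrA -[_ * P _]mulrA [monomial_inv a * _]mulrC monomial_invK mulr1.
Qed.

(** The ratios q_i / q_i0 and their inverses generate the torus ring over [k], and the image of an
    inverse is forced. *)
Lemma torus_rmorph_eq (C : comPzRingType) (f g : {rmorphism T -> C}) :
    (forall c, f (torus_const E c) = g (torus_const E c)) ->
    (forall i, f (coord_ratio i i0) = g (coord_ratio i i0)) ->
  f =1 g.
Proof.
move=> fgC fgX x; have [p [a [_ xa]]] := torus_fraction x.
have fg q : f (dehomogenize q) = g (dehomogenize q).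
  pose f' : {rmorphism S -> C} := f \o dehomogenize.
  pose g' : {rmorphism S -> C} := g \o dehomogenize.
  apply: (@poly_rmorph_eq _ _ _ f' g') => [c|i] /=.
    by rewrite dehomogenizeC.
  by rewrite dehomogenizeX.
have [y y1] := dehomogenize_unit a.
have fgy : f y = g y.
  rewrite -[f y]mulr1 -(rmorph1 g) -y1 rmorphM -fg mulrA -rmorphM.
  by rewrite [y * _]mulrC y1 rmorph1 mul1r.
by rewrite -[x]mulr1 -y1 mulrA xa !rmorphM fg fgy.
Qed.

End TorusRing.
(** * Weights and initial forms *)

Section Weights.
Variables (k : fieldType) (E : finType) (R : realType) (w : E -> R).
Local Notation S := {mpoly k[#|E|]}.
Local Notation L := (laurent k E).
Local Notation P := (@poly_to_laurent k E).
Local Notation var i := ('X_(enum_rank i) : S).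
Local Notation wt := (weight w).

Lemma weight0 : wt 0%MM = 0.
Proof. by rewrite /weight big1 // => i _; rewrite mnm0E mulr0. Qed.

Lemma weightD a b : wt (a + b)%MM = wt a + wt b.
Proof.
rewrite /weight -big_split; apply: eq_bigr => i _.
by rewrite mnmDE natrD mulrDr.
Qed.

Lemma weight_var i : wt U_(enum_rank i)%MM = w i.
Proof.
rewrite /weight (bigD1 i) //= mnm1E eqxx mulr1 big1 ?addr0 // => j ji.
by rewrite mnm1E (inj_eq enum_rank_inj) eq_sym (negbTE ji) mulr0.
Qed.

(** All exponents of [x] have weight in [Q]. Elements of the fraction field carry no list of
    exponents, so the condition is put on some fraction representing [x]. *)
Definition weight_in (Q : R -> Prop) (x : L) : Prop :=
  exists (f : S) (a : 'X_{1..#|E|}), x = P f * monomial_inv a /\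
    forall m, m \in msupp f -> Q (wt m - wt a).

Lemma monomial_invD a b :
  monomial_inv (a + b)%MM = monomial_inv a * monomial_inv b :> L.
Proof. by apply: val_inj; rewrite /= mpolyXD rmorphM invfM. Qed.

Lemma weight_in0 Q : weight_in Q 0.
Proof. by exists 0, 0%MM; rewrite rmorph0 mul0r msupp0; split. Qed.

Lemma weight_inD Q x y : weight_in Q x -> weight_in Q y -> weight_in Q (x + y).
Proof.
move=> [f [a [-> fQ]]] [g [b [-> gQ]]].
exists (f * 'X_[b] + g * 'X_[a]), (a + b)%MM; split.
  rewrite rmorphD !rmorphM monomial_invD mulrDl; congr (_ + _).
    by rewrite [_ * monomial_inv b]mulrC mulrA -[P f * _ * _]mulrA monomial_invK mulr1.
  by rewrite mulrA -[P g * _ * _]mulrA monomial_invK mulr1.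
move=> m /msuppD_le; rewrite mem_cat => /orP[] /msuppM_le/allpairsP[[m1 m2] /= [mf]].
  by rewrite msuppX inE => /eqP-> ->; rewrite !weightD opprD addrACA subrr addr0; apply: fQ.
by rewrite msuppX inE => /eqP-> ->; rewrite !weightD [wt a + _]addrC opprD addrACA subrr addr0; apply: gQ.
Qed.

Lemma weight_inM Q1 Q2 Q x y : (forall s t, Q1 s -> Q2 t -> Q (s + t)) ->
  weight_in Q1 x -> weight_in Q2 y -> weight_in Q (x * y).
Proof.
move=> Q12 [f [a [-> fQ]]] [g [b [-> gQ]]].
exists (f * g), (a + b)%MM; split; first by rewrite rmorphM monomial_invD mulrACA.
move=> m /msuppM_le/allpairsP[[m1 m2] /= [mf mg ->]].
by rewrite !weightD opprD addrACA; apply: Q12; [apply: fQ|apply: gQ].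
Qed.

Lemma weight_in_sub (Q Q' : R -> Prop) x : (forall s, Q s -> Q' s) ->
  weight_in Q x -> weight_in Q' x.
Proof.
by move=> QQ' [f [a [xE fQ]]]; exists f, a; split=> // m /fQ/QQ'.
Qed.

(** Cross-multiplying two fractions of [x] matches an exponent of one numerator with an exponent of
    the other of the same relative weight. That weight would satisfy both [Q] and [Q'], so the
    numerator has no exponents at all. *)
Lemma weight_in_disjoint (Q Q' : R -> Prop) x : (forall s, Q s -> Q' s -> False) ->
  weight_in Q x -> weight_in Q' x -> x = 0.
Proof.
move=> QQ' [f [a [xf fQ]]] [g [b [xg gQ]]].
have e : f * 'X_[b] = g * 'X_[a].
  apply: poly_to_laurent_inj; rewrite !rmorphM.
  transitivity (x * P 'X_[a] * P 'X_[b]).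
    by rewrite xf -[P f * _ * _]mulrA [_ * P 'X_[a]]mulrC monomial_invK mulr1.
  by rewrite xg mulrAC -[P g * _ * _]mulrA [_ * P 'X_[b]]mulrC monomial_invK mulr1.
suff f0 : f = 0 by rewrite xf f0 rmorph0 mul0r.
apply/mpolyP => m; rewrite mcoeff0; apply/eqP; rewrite -[_ == _]negbK -mcoeff_msupp.
apply/negP => mf; have : (m + b)%MM \in msupp (g * 'X_[a]).
  by rewrite -e mcoeff_msupp addmC mcoeffMX -mcoeff_msupp.
rewrite mulrC => /msuppM_le/allpairsP[[m1 m2] /= []].
rewrite msuppX inE => /eqP-> mg mE.
apply: (QQ' (wt m - wt a)); first exact: fQ.
have -> : wt m - wt a = wt m2 - wt b; last exact: gQ.
have := congr1 wt mE; rewrite !weightD => mE'.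
by apply/eqP; rewrite subr_eq addrAC eq_sym subr_eq addrC -mE'.
Qed.

Definition weight_part (c : R) (f : S) : S :=
  \sum_(m <- msupp f | wt m == c) f@_m *: 'X_[m].

Lemma weight_part_rest c f :
  f - weight_part c f = \sum_(m <- msupp f | wt m != c) f@_m *: 'X_[m].
Proof.
apply/eqP; rewrite subr_eq addrC {1}[f]mpolyE (bigID (fun m => wt m == c)) /=.
exact: eqxx.
Qed.

Lemma msupp_sum_monomials (Q : pred 'X_{1..#|E|}) (s : seq 'X_{1..#|E|}) (f : 'X_{1..#|E|} -> k) m :
  m \in msupp (\sum_(m <- s | Q m) f m *: 'X_[m]) -> m \in s /\ Q m.
Proof.
elim: s => [|m' s IHs]; first by rewrite big_nil msupp0.
rewrite big_cons; case: ifP => [Qm'|_]; last first.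
  by case/IHs=> ms Qm; rewrite inE ms orbT.
move=> /msuppD_le; rewrite mem_cat => /orP[/msuppZ_le|/IHs[ms Qm]]; last first.
  by rewrite inE ms orbT.
by rewrite msuppX inE => /eqP->; rewrite inE eqxx.
Qed.

Lemma msupp_weight_part c f m :
  m \in msupp (weight_part c f) -> m \in msupp f /\ wt m = c.
Proof. by case/msupp_sum_monomials=> ? /eqP. Qed.

Lemma mcoeff_weight_part c f m :
  (weight_part c f)@_m = if wt m == c then f@_m else 0.
Proof.
have := congr1 (mcoeff m) (weight_part_rest c f); rewrite mcoeffB.
case: ifP => mc.
  rewrite [RHS]memN_msupp_eq0 => [/eqP|]; last first.
    by apply/negP => /msupp_sum_monomials[_]; rewrite mc.
  by rewrite subr_eq0 => /eqP.
move=> _; apply: memN_msupp_eq0.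
by apply/negP => /msupp_sum_monomials[_]; rewrite mc.
Qed.

Lemma initial_formE c f m0 : m0 \in msupp f -> wt m0 = c ->
  (forall m, m \in msupp f -> c <= wt m) -> initial_form w f = weight_part c f.
Proof.
move=> m0f m0c fc; rewrite /initial_form /weight_part.
rewrite big_seq_cond [RHS]big_seq_cond; apply: eq_bigl => m.
case mf: (m \in msupp f) => //=; apply/allP/eqP => [mmin|-> //].
by apply/eqP; rewrite eq_le fc // -m0c mmin.
Qed.

End Weights.

Section GeneratedIdealMembership.
Variables (A : comPzRingType) (X : A -> Prop).

Lemma mem_gen_ideal x : X x -> gen_ideal X x.
Proof.
move=> Xx; exists [:: (1, x)]; last by rewrite big_seq1 mul1r.
by move=> p; rewrite inE => /eqP->.
Qed.

Lemma gen_ideal_rmorph0 (C : comPzRingType) (f : {rmorphism A -> C}) x :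
  (forall y, X y -> f y = 0) -> gen_ideal X x -> f x = 0.
Proof.
move=> fX [s sX ->]; rewrite rmorph_sum big_seq big1 // => p /sX/fX fp.
by rewrite rmorphM fp mulr0.
Qed.

End GeneratedIdealMembership.

Lemma seq_argmin (R : realType) (T : eqType) (h : T -> R) (s : seq T) :
  s != [::] -> exists2 x, x \in s & forall y, y \in s -> h x <= h y.
Proof.
elim: s => // x [|z s] IHs _.
  by exists x => [|y]; rewrite ?inE // => /eqP->.
have [//|y ys ymin] := IHs; have [xy|yx] := leP (h x) (h y).
  exists x => [|u]; first exact: mem_head.
  by rewrite inE => /orP[/eqP-> //|/ymin]; apply: le_trans.
exists y => [|u]; first by rewrite inE ys orbT.
by rewrite inE => /orP[/eqP->|/ymin //]; apply: ltW.
Qed.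

Lemma mul_diff (C : comNzRingType) (x1 x2 y1 y2 : C) :
  y1 * y2 - x1 * x2 = (y1 - x1) * (y2 - x2) + ((y1 - x1) * x2 + x1 * (y2 - x2)).
Proof. by ring. Qed.

(** * Solving for the dependent coordinates *)

Section Substitution.
Variables (k : fieldType) (E : finType) (D : pred E).
Variables (A : E -> 'X_{1..#|E|}) (G : E -> {mpoly k[#|E|]}).
Local Notation S := {mpoly k[#|E|]}.
Local Notation L := (laurent k E).
Local Notation P := (@poly_to_laurent k E).
Local Notation var i := ('X_(enum_rank i) : S).

Definition subst_value (i : E) : L :=
  if D i then P (G i) * monomial_inv (A i) else P (var i).

Definition subst : S -> L :=
  mmap (P \o @mpolyC #|E| k) (fun j => subst_value (enum_val j)).
HB.instance Definition _ := GRing.RMorphism.on subst.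

Lemma substC c : subst c%:MP = P c%:MP.
Proof. exact: mmapC. Qed.

Lemma substX i : subst (var i) = subst_value i.
Proof. by rewrite /subst mmapX mmap1U enum_rankK. Qed.

Lemma subst_varXn i e : subst (var i ^+ e) = subst_value i ^+ e.
Proof. by rewrite rmorphXn /= substX. Qed.

End Substitution.
(** * Initial degenerations with a chart *)

Section Chart.
Variables (k : closedFieldType) (E : finType) (R : realType) (w : E -> R).
Local Notation S := {mpoly k[#|E|]}.
Local Notation L := (laurent k E).
Local Notation P := (@poly_to_laurent k E).
Local Notation var i := ('X_(enum_rank i) : S).
Local Notation wt := (weight w).

(** [D] marks the dependent coordinates, and [i0] is a free one used to dehomogenize. By [AD] and
    [GD] the relations solve for dependent coordinates in terms of free ones; by [vanishI] they cut
    out zeros of [I] in the torus. *)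
Variables (I : ideal S) (i0 : E) (D : pred E).
Variables (A : E -> 'X_{1..#|E|}) (G : E -> S).

Hypothesis i0D : ~~ D i0.
Hypothesis AD : forall d d', D d -> D d' -> A d (enum_rank d') = 0%N.
Hypothesis GD : forall d d' m, D d -> D d' -> m \in msupp (G d) ->
  m (enum_rank d') = 0%N.
Hypothesis G_homog : forall d, D d -> G d \is (mdeg (A d)).+1.-homog.
Hypothesis relI : forall d, D d -> I ('X_[A d] * var d - G d).
Hypothesis G_weight : forall d m, D d -> m \in msupp (G d) ->
  wt (A d) + w d <= wt m.
Hypothesis vanishI : forall y : E -> k, (forall i, y i != 0) ->
    (forall d, D d -> eval_at y ('X_[A d] * var d - G d) = 0) ->
  forall f, I f -> eval_at y f = 0.
Hypothesis trop : in_trop w I.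

(** By [G_weight] no term of [G d] is lighter than q^A_d q_d; this is the part that survives in the
    initial form of the relation. *)
Let G' d := weight_part w (wt (A d) + w d) (G d).
Let J := initial_ideal w I.
Let JL := laurent_ideal J.
Let J0 := contraction (val : torus_ring k E -> L) JL.

Let G'D d d' m : D d -> D d' -> m \in msupp (G' d) -> m (enum_rank d') = 0%N.
Proof. by move=> Dd Dd' /msupp_weight_part[mG _]; apply: GD mG. Qed.

Let G'_homog d : D d -> G' d \is (mdeg (A d)).+1.-homog.
Proof.
move=> Dd; apply/dhomogP => m /msupp_weight_part[mG _].
by have /dhomogP := G_homog Dd; apply.
Qed.

(** The monomial q^A_d q_d contains a dependent variable, so it cannot cancel against [G d], and it
    has the least weight in the relation. *)
Lemma initial_relation d : D d -> J ('X_[A d] * var d - G' d).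
Proof.
move=> Dd; apply: mem_gen_ideal; exists ('X_[A d] * var d - G d); first exact: relI.
rewrite -mpolyXD; set m0 := (A d + _)%MM.
have m0w : wt m0 = wt (A d) + w d by rewrite weightD weight_var.
have m0G : m0 \notin msupp (G d).
  apply/negP => /(GD Dd Dd); rewrite /m0 mnmDE mnm1E eqxx AD //.
have m0r : m0 \in msupp ('X_[m0] - G d).
  rewrite mcoeff_msupp mcoeffB mcoeffX eqxx (memN_msupp_eq0 m0G) subr0.
  exact: oner_neq0.
rewrite (@initial_formE _ _ _ _ (wt (A d) + w d) _ m0) //; last first.
  move=> m /msuppB_le; rewrite mem_cat msuppX inE => /orP[/eqP->|]; first by rewrite m0w.
  exact: G_weight.
apply/mpolyP => m; rewrite mcoeff_weight_part !mcoeffB mcoeff_weight_part mcoeffX.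
case: (m0 =P m) => [<-|_]; first by rewrite m0w eqxx.
by case: ifP => // _; rewrite subr0.
Qed.

(** Otherwise in_w I would contain a monomial, which is a unit in the Laurent ring, against
    [trop]. *)
Lemma initial_relation_neq0 d : D d -> G' d != 0.
Proof.
move=> Dd; apply/eqP => G'0; apply: trop.
have := initial_relation Dd; rewrite G'0 subr0 -mpolyXD => Jm.
rewrite -(monomial_invK k (A d + U_(enum_rank d))%MM) mulrC; apply: idealM.
by apply: mem_gen_ideal; exists 'X_[A d + U_(enum_rank d)].
Qed.

Local Notation psi := (subst D A G).
Local Notation psi' := (subst D A G').

Lemma meval_lift (c : E -> k) : (forall i, c i != 0) ->
  exists phi : {rmorphism L -> k}, forall f, phi (P f) = eval_at c f.
Proof.
move=> c0; have cc i : c i * (c i)^-1 = 1 by rewrite divff.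
have [phi [phiC phiX]] := @laurent_lift k E k idfun c _ cc.
exists phi => f; pose f1 : {rmorphism S -> k} := phi \o P.
pose f2 : {rmorphism S -> k} := meval (fun j => c (enum_val j)).
apply: (@poly_rmorph_eq _ _ _ f1 f2) => [a|i]; rewrite /f1 /f2 /=.
  by rewrite phiC mevalC.
by rewrite phiX mevalXU enum_rankK.
Qed.

Lemma eval_at_eq (y c : E -> k) (f : S) :
    (forall m d, m \in msupp f -> D d -> m (enum_rank d) = 0%N) ->
    (forall i, ~~ D i -> y i = c i) ->
  eval_at y f = eval_at c f.
Proof.
move=> fD yc; pose f1 : {rmorphism S -> k} := meval (fun j => y (enum_val j)).
pose f2 : {rmorphism S -> k} := meval (fun j => c (enum_val j)).
apply: (mpoly_rmorph_eq (f := f1) (g := f2)) => [a|m j mf mj]; rewrite /f1 /f2 /=.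
  by rewrite !mevalC.
rewrite !mevalXU yc //; apply: contra mj => Dj.
by rewrite -[j]enum_valK (fD m).
Qed.

(** At a torus point where all [G d] are nonzero, the free coordinates extend to a torus point
    satisfying the relations, and [f] vanishes there. So the numerator [F] of [psi f], multiplied by
    the coordinates and the [G d], vanishes everywhere, and the extra factors are nonzero
    polynomials. *)
Lemma subst_I f : I f -> psi f = 0.
Proof.
move=> If; have [F [a psiE]] := laurent_fraction (psi f).
suff F0 : F = 0 by rewrite psiE F0 rmorph0 mul0r.
pose H := F * \prod_i var i * \prod_(d | D d) G d.
suff /eqP : H = 0.
  rewrite !mulf_eq0 => /orP[/orP[/eqP //|]|] /prodf_eq0[i].
    by move=> _; rewrite -msupp_eq0 msuppX.
  move=> Di /eqP Gi0; have := initial_relation_neq0 Di.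
  by rewrite /G' Gi0 /weight_part msupp0 big_nil eqxx.
apply: mpoly_zero_of_vanishing => c'.
pose c i := c' (enum_rank i).
have evalE g : g.@[c'] = eval_at c g.
  by apply: meval_eq => j; rewrite /c enum_valK.
rewrite /H !mevalM !rmorph_prod /= evalE.
have [/existsP[i /eqP ci]|/existsPn c0] := boolP [exists i, c i == 0].
  by rewrite (bigD1 i) //= mevalXU -/(c i) ci mul0r mulr0 mul0r.
have [/existsP[d /andP[Dd /eqP Gd]]|/existsPn G0] :=
    boolP [exists d, D d && (eval_at c (G d) == 0)].
  by rewrite [X in _ * X](bigD1 d) //= evalE Gd mul0r mulr0.
suff -> : eval_at c F = 0 by rewrite !mul0r.
(* The free coordinates of [c] are kept and the dependent ones are recomputed from the relations;
   evaluating at [y] then amounts to applying [psi] and evaluating at [c]. *)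
pose y i := if D i then eval_at c (G i) / eval_at c 'X_[A i] else c i.
have yc i : ~~ D i -> y i = c i by rewrite /y => /negbTE->.
have mon0 m : eval_at c 'X_[m] != 0.
  rewrite /eval_at mpolyXE_id rmorph_prod /=; apply/prodf_neq0 => j _.
  by rewrite rmorphXn /= mevalXU expf_neq0.
have y0 i : y i != 0.
  rewrite /y; case: ifP => // Di; rewrite mulf_neq0 ?invr_neq0 //.
  by have := G0 i; rewrite Di.
have [phi phiP] := meval_lift c0.
have phi_psi g : phi (psi g) = eval_at y g.
  pose f1 : {rmorphism S -> k} := phi \o psi.
  pose f2 : {rmorphism S -> k} := meval (fun j => y (enum_val j)).
  apply: (@poly_rmorph_eq _ _ _ f1 f2) => [b|i]; rewrite /f1 /f2 /=.
    by rewrite substC phiP /eval_at !mevalC.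
  rewrite substX mevalXU enum_rankK /subst_value /y; case: ifP => Di; last first.
    by rewrite phiP /eval_at mevalXU enum_rankK.
  rewrite rmorphM phiP; congr (_ * _); apply: (mulfI (mon0 (A i))).
  by rewrite divff // -phiP -rmorphM monomial_invK rmorph1.
have yI : eval_at y f = 0.
  apply: vanishI If => // d Dd; rewrite /eval_at mevalB mevalM mevalXU enum_rankK.
  rewrite -!/(eval_at y _) (eval_at_eq _ yc) => [|m d' + Dd']; last first.
    by rewrite msuppX inE => /eqP->; apply: AD.
  rewrite (eval_at_eq _ yc) => [|m d' mG Dd']; last exact: GD mG.
  by rewrite /y Dd mulrC divfK // subrr.
apply/eqP; move/eqP: yI; rewrite -phi_psi psiE rmorphM phiP mulf_eq0 => /orP[//|inv0].
have := congr1 phi (monomial_invK k a); rewrite rmorphM (eqP inv0) mulr0 rmorph1.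
by move/esym/eqP; rewrite oner_eq0.
Qed.

Let eq_wt (c : R) (s : R) := s = c.
Let gt_wt (c : R) (s : R) := c < s.

(** [x] is the component of weight [c] of [y], possibly zero, and [y] has no lighter component. *)
Let lowest c (x y : L) := weight_in w (eq_wt c) x /\ weight_in w (gt_wt c) (y - x).

Let lowestM c1 c2 x1 y1 x2 y2 :
  lowest c1 x1 y1 -> lowest c2 x2 y2 -> lowest (c1 + c2) (x1 * x2) (y1 * y2).
Proof.
move=> [x1c y1c] [x2c y2c]; split.
  by apply: weight_inM x1c x2c => s t -> ->.
have -> : y1 * y2 - x1 * x2 =
    (y1 - x1) * (y2 - x2) + ((y1 - x1) * x2 + x1 * (y2 - x2)).
  exact: mul_diff.
apply: weight_inD; first by apply: weight_inM y1c y2c => s t; apply: ltrD.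
apply: weight_inD.
  by apply: weight_inM y1c x2c => s t cs ->; rewrite /gt_wt ltrD2r.
by apply: weight_inM x1c y2c => s t -> cs; rewrite /gt_wt ltrD2l.
Qed.

Let lowest1 : lowest 0 1 1.
Proof.
split; last by rewrite subrr; apply: weight_in0.
exists 1, 0%MM; split; first by rewrite -mpolyX0 monomial_invK.
by move=> m; rewrite msupp1 inE => /eqP->; apply: subrr.
Qed.

Let lowest_value i : lowest (w i) (subst_value D A G' i) (subst_value D A G i).
Proof.
rewrite /lowest /subst_value; case: ifP => Di; last first.
  split; last by rewrite subrr; apply: weight_in0.
  exists (var i), 0%MM; split.
    by rewrite -[LHS]mulr1 -(monomial_invK k 0%MM) mpolyX0 rmorph1 mul1r.
  by move=> m; rewrite msuppX inE => /eqP->; rewrite weight_var weight0 subr0.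
split.
  exists (G' i), (A i); split=> // m /msupp_weight_part[_ ->].
  by rewrite addrAC subrr add0r.
exists (G i - G' i), (A i); split; first by rewrite (rmorphB P) mulrBl.
move=> m; rewrite weight_part_rest => /msupp_sum_monomials[mG mw].
rewrite /gt_wt ltrBrDr addrC lt_neqAle eq_sym mw; exact: G_weight.
Qed.

Let lowest_monomial m : lowest (wt m) (psi' 'X_[m]) (psi 'X_[m]).
Proof.
rewrite monomialE !rmorph_prod /weight.
apply: (big_rec3 lowest) => [|i c x y _ cxy]; first exact: lowest1.
apply: lowestM cxy.
rewrite /= !subst_varXn.
elim: (m _) => [|e IHe]; first by rewrite !expr0 mulr0.
by rewrite !exprS -natr1 mulrDr mulr1 addrC; apply: lowestM IHe; apply: lowest_value.
Qed.

Let weight_in_scale Q c x : weight_in w Q x -> weight_in w Q (P c%:MP * x).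
Proof.
move=> [f [a [-> fQ]]]; exists (c%:MP * f), a; split; first by rewrite rmorphM mulrA.
by move=> m; rewrite mul_mpolyC => /msuppZ_le; apply: fQ.
Qed.

Let weight_in_sum Q (s : seq 'X_{1..#|E|}) (C : pred 'X_{1..#|E|}) (F : 'X_{1..#|E|} -> L) :
    (forall m, m \in s -> C m -> weight_in w Q (F m)) ->
  weight_in w Q (\sum_(m <- s | C m) F m).
Proof.
move=> FQ; rewrite big_seq_cond; elim/big_rec: _ => [|m x /andP[ms Cm] xQ].
  exact: weight_in0.
by apply: weight_inD xQ; apply: FQ.
Qed.

Let substZ B c m : subst D A B (c *: 'X_[m]) = P c%:MP * subst D A B 'X_[m].
Proof. by rewrite -mul_mpolyC rmorphM /= substC. Qed.

(* The part of lowest weight of [psi f = 0] is [psi' (initial_form w f)]. *)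
Lemma subst_initial_form f : I f -> psi' (initial_form w f) = 0.
Proof.
move=> If; have [->|f0] := eqVneq f 0.
  by rewrite /initial_form msupp0 big_nil rmorph0.
have [|m0 m0f m0min] := @seq_argmin R _ wt (msupp f); first by rewrite msupp_eq0.
rewrite (initial_formE m0f erefl m0min); set c := wt m0.
apply: (@weight_in_disjoint _ _ _ w (eq_wt c) (gt_wt c)).
- by move=> s ->; rewrite /gt_wt ltxx.
- rewrite /weight_part rmorph_sum /=; apply: weight_in_sum => m _ /eqP mc.
  by rewrite substZ -mc; apply: weight_in_scale; case: (lowest_monomial m).
(* As [psi f] is zero, the element of weight [c] is minus the rest of [psi f], whose weights all
   exceed [c]; an element satisfying both weight conditions is zero. *)
have -> : psi' (weight_part w c f) = - (psi f - psi' (weight_part w c f)).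
  by rewrite subst_I // sub0r opprK.
rewrite -mulN1r -[-1](rmorphN1 P) -mpolyC1 -mpolyCN; apply: weight_in_scale.
rewrite -[f in psi f](subrK (weight_part w c f)) rmorphD -addrA.
apply: weight_inD.
  rewrite weight_part_rest rmorph_sum /=; apply: weight_in_sum => m mf mc.
  rewrite substZ; apply: weight_in_scale.
  have cm : c < wt m by rewrite lt_neqAle eq_sym mc m0min.
  have [mlow mgt] := lowest_monomial m.
  rewrite -[psi _](subrK (psi' 'X_[m])); apply: weight_inD.
    by apply: weight_in_sub mgt => s; apply: lt_trans.
  by apply: weight_in_sub mlow => s ->.
rewrite /weight_part !rmorph_sum -sumrB /=; apply: weight_in_sum => m _ /eqP mc.
rewrite !substZ -mulrBr; apply: weight_in_scale; rewrite -mc.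
by case: (lowest_monomial m).
Qed.

(** [Psi] is [psi'] extended to Laurent polynomials, and its kernel is the whole ideal of the
    initial degeneration: modulo [JL] every dependent q_d equals its substituted value, so f is
    congruent to [psi' f]. *)
Lemma generic_point : exists Psi : {rmorphism L -> {fraction S}},
  (forall f, Psi (P f) = val (psi' f)) /\ forall x, JL x <-> Psi x = 0.
Proof.
pose u i := val (subst_value D A G' i).
have u0 i : u i != 0.
  rewrite /u /subst_value; case: ifP => Di /=.
    rewrite mulf_neq0 ?invr_eq0 ?tofracX_neq0 // tofrac_eq0.
    exact: initial_relation_neq0.
  exact: tofracX_neq0.
have uu i : u i * (u i)^-1 = 1 by rewrite divff.
pose g : {rmorphism k -> {fraction S}} := @tofrac S \o @mpolyC #|E| k.
have [Psi [PsiC PsiX]] := @laurent_lift k E _ g u _ uu.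
have PsiP f : Psi (P f) = val (psi' f).
  pose f1 : {rmorphism S -> {fraction S}} := Psi \o P.
  pose f2 : {rmorphism S -> {fraction S}} := (val : L -> {fraction S}) \o psi'.
  apply: (@poly_rmorph_eq _ _ _ f1 f2) => [c|i]; rewrite /f1 /f2 /=.
    by rewrite PsiC substC.
  by rewrite PsiX substX.
exists Psi; split=> // x; split.
  apply: gen_ideal_rmorph0 => _ [f Jf ->]; rewrite PsiP.
  rewrite (gen_ideal_rmorph0 (f := psi') _ Jf) ?rmorph0 // => _ [h Ih ->].
  exact: subst_initial_form.
have [f [a ->]] := laurent_fraction x.
rewrite rmorphM => /eqP; rewrite mulf_eq0 => /orP[|/eqP inv0]; last first.
  have := congr1 Psi (monomial_invK k a); rewrite rmorphM inv0 mulr0 rmorph1.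
  by move/esym/eqP; rewrite oner_eq0.
rewrite PsiP => /eqP psi0; rewrite mulrC; apply: idealM.
have {}psi0 : psi' f = 0 by apply: val_inj; rewrite psi0.
apply/quot_map_eq0.
pose f1 : {rmorphism S -> quotient_ring JL} := quot_map JL \o P.
pose f2 : {rmorphism S -> quotient_ring JL} := quot_map JL \o psi'.
suff : f1 f = f2 f by rewrite /f1 /f2 /= psi0 rmorph0.
apply: poly_rmorph_eq => [c|i]; rewrite /f1 /f2 /= ?substC // substX /subst_value.
case: ifP => // Di; apply/eqP; rewrite -subr_eq0 -rmorphB; apply/eqP/quot_map_eq0.
have -> : P (var i) - P (G' i) * monomial_inv (A i) =
    monomial_inv (A i) * P ('X_[A i] * var i - G' i).
  rewrite (rmorphB P) (rmorphM P) mulrBr mulrA [_ * P 'X_[A i]]mulrC.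
  rewrite monomial_invK mul1r.
  by rewrite [P (G' i) * _]mulrC.
by apply/idealM/mem_gen_ideal; exists ('X_[A i] * var i - G' i) => //; apply: initial_relation.
Qed.

Lemma chart_irreducible : spec_irreducible (torus_scheme J).
Proof.
have [Psi [_ JPsi]] := generic_point.
exact: prime_contraction_irreducible JPsi trop.
Qed.

(** * The coordinate ring of the initial degeneration and its smoothness *)

Local Notation T := (torus_ring k E).
Local Notation B := (torus_scheme J).
Let coordinate i : B := quot_map J0 (coord_ratio k i i0).

(** Units y_i with y_i0 = 1 that satisfy the initial relations define a map out of the coordinate
    ring: applying [psi'] first does not change [phi], and [psi'] kills the numerators of elements
    of [JL]. *)
Lemma scheme_lift (C : comPzRingType) (g : {rmorphism k -> C}) (y y' : E -> C) :
    (forall i, y i * y' i = 1) -> y i0 = 1 ->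
    (forall f : {rmorphism S -> C}, (forall c, f c%:MP = g c) ->
       (forall i, f (var i) = y i) ->
       forall d, D d -> f 'X_[A d] * y d = f (G' d)) ->
  exists l : {rmorphism B -> C},
    (forall c, l (torus_structure J c) = g c) /\
    (forall i, l (coordinate i) = y i).
Proof.
move=> yy' y01 yG; have [Psi [PsiP JPsi]] := generic_point.
have [phi [phiC phiX]] := laurent_lift g yy'.
pose f1 : {rmorphism S -> C} := phi \o P.
have f1inv a : f1 'X_[a] * phi (monomial_inv a) = 1.
  by rewrite /f1 /= -rmorphM monomial_invK rmorph1.
have phi_subst f : phi (P f) = phi (psi' f).
  pose f2 : {rmorphism S -> C} := phi \o psi'.
  apply: (@poly_rmorph_eq _ _ _ f1 f2) => [c|i]; rewrite /f1 /f2 /=.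
    by rewrite substC.
  rewrite substX /subst_value; case: ifP => // Di.
  rewrite rmorphM -[phi (P (G' i))]/(f1 (G' i)) -(yG f1) // phiX.
  by rewrite mulrAC f1inv mul1r.
have phiJ x : JL x -> phi x = 0.
  have [f [a ->]] := laurent_fraction x => /JPsi.
  rewrite rmorphM => /eqP; rewrite mulf_eq0 => /orP[|/eqP inv0]; last first.
    have := congr1 Psi (monomial_invK k a); rewrite rmorphM inv0 mulr0 rmorph1.
    by move/esym/eqP; rewrite oner_eq0.
  rewrite PsiP => /eqP psi0; have {}psi0 : psi' f = 0 by apply: val_inj; rewrite psi0.
  by rewrite rmorphM phi_subst psi0 rmorph0 mul0r.
pose phiT : {rmorphism T -> C} := phi \o (val : T -> L).
have [l lE] := @quot_lift _ _ J0 phiT (fun x => @phiJ (val x)).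
exists l; split=> [c|i].
  by rewrite /torus_structure /= lE /phiT /= phiC.
rewrite lE /phiT /= rmorphM phiX; have := f1inv U_(enum_rank i0)%MM.
by rewrite /f1 /= phiX y01 mul1r => ->; rewrite mulr1.
Qed.

Let scheme_poly : {rmorphism S -> B} := quot_map J0 \o dehomogenize i0.

Lemma scheme_poly_J f d : J f -> f \is d.-homog -> scheme_poly f = 0.
Proof.
move=> Jf fd; apply/quot_map_eq0.
suff JLf : JL (val (dehomogenize i0 f)) by exact: JLf.
rewrite (dehomogenize_homog i0 fd) mulrC.
by apply/idealM/mem_gen_ideal; exists f.
Qed.

Lemma scheme_relation d : D d ->
  scheme_poly 'X_[A d] * coordinate d = scheme_poly (G' d).
Proof.
move=> Dd; apply/eqP; rewrite -subr_eq0.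
have -> : coordinate d = scheme_poly (var d) by rewrite /scheme_poly /= dehomogenizeX.
rewrite -rmorphM -rmorphB; apply/eqP.
apply: (@scheme_poly_J _ (mdeg (A d)).+1); first exact: initial_relation.
apply: rpredB; last exact: G'_homog.
by rewrite -mpolyXD dhomogX /= mdegD mdeg1 addn1.
Qed.

Lemma scheme_polyC c : scheme_poly c%:MP = torus_structure J c.
Proof. by rewrite /scheme_poly /= dehomogenizeC. Qed.

Lemma scheme_polyX i : scheme_poly (var i) = coordinate i.
Proof. by rewrite /scheme_poly /= dehomogenizeX. Qed.

Lemma scheme_rmorph_eq (C : comPzRingType) (f g : {rmorphism B -> C}) :
    (forall c, f (torus_structure J c) = g (torus_structure J c)) ->
    (forall i, f (coordinate i) = g (coordinate i)) ->
  f =1 g.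
Proof.
move=> fgC fgX b; have [x ->] := quot_map_surj b.
pose f' : {rmorphism T -> C} := f \o quot_map J0.
pose g' : {rmorphism T -> C} := g \o quot_map J0.
by apply: (@torus_rmorph_eq k E i0 C f' g').
Qed.

(** If c' lifts the inverse, then e = 1 - b c' lies in the kernel, so e^2 = 0 and b c' (1 + e) = (1
    - e) (1 + e) = 1. *)
Lemma unit_of_unit_mod_square_zero (C C' : comPzRingType) (pr : {rmorphism C -> C'}) :
    (forall c, exists b, pr b = c) ->
    (forall x y, pr x = 0 -> pr y = 0 -> x * y = 0) ->
  forall b c, pr b * c = 1 -> exists b', b * b' = 1.
Proof.
move=> surj sq b c bc; have [c' cE] := surj c.
have e0 : pr (1 - b * c') = 0 by rewrite rmorphB rmorph1 rmorphM cE bc subrr.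
exists (c' * (1 + (1 - b * c'))); set e := 1 - b * c' in e0 *.
have -> : b * (c' * (1 + e)) = (1 - e) * (1 + e).
  by rewrite mulrA; congr (_ * _); rewrite /e opprB addrC subrK.
by rewrite mulrDr mulr1 mulrBl mul1r (sq e e) // subr0 subrK.
Qed.

Let coordinate_inv i : B := quot_map J0 (coord_ratio k i0 i).

Let coordinateK i : coordinate i * coordinate_inv i = 1.
Proof. by rewrite /coordinate /coordinate_inv -rmorphM coord_ratioK rmorph1. Qed.

Let coordinate0 : coordinate i0 = 1.
Proof. by rewrite /coordinate coord_ratio_id rmorph1. Qed.

Lemma rmorph_free_eq (C : comPzRingType) (f g : {rmorphism S -> C}) (p : S) :
    (forall c, f c%:MP = g c%:MP) -> (forall i, ~~ D i -> f (var i) = g (var i)) ->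
    (forall m d, m \in msupp p -> D d -> m (enum_rank d) = 0%N) ->
  f p = g p.
Proof.
move=> fgC fgX pD; apply: mpoly_rmorph_eq => // m j mp mj.
rewrite -[j]enum_valK fgX //; apply: contra mj => Dj.
by rewrite -[j]enum_valK (pD m).
Qed.

Let A_free d : D d -> forall m d', m \in msupp ('X_[A d] : S) -> D d' ->
  m (enum_rank d') = 0%N.
Proof. by move=> Dd m d'; rewrite msuppX inE => /eqP->; apply: AD. Qed.

(** The free coordinates lift arbitrarily along the thickening and stay units; the initial relations
    then determine the dependent ones. *)
Lemma chart_formally_smooth : formally_smooth (torus_structure J).
Proof.
move=> C C' pr g h surj sq hg.
have [lft lftE] := choice surj.
(* The value 1 on [D] is a placeholder that [y] replaces; the value 1 at [i0] is forced, as q_i0 /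
   q_i0 = 1. *)
pose y1 i := if D i then 1 else if i == i0 then 1 else lft (h (coordinate i)).
have pr_y1 i : ~~ D i -> pr (y1 i) = h (coordinate i).
  move=> /negbTE Di; rewrite /y1 Di; case: eqP => [->|_]; last exact: lftE.
  by rewrite coordinate0 !rmorph1.
have unit_h i : h (coordinate i) * h (coordinate_inv i) = 1.
  by rewrite -rmorphM coordinateK rmorph1.
have y1_unit i : exists z, y1 i * z = 1.
  case Di: (D i); first by exists 1; rewrite /y1 Di mulr1.
  apply: (unit_of_unit_mod_square_zero surj sq (c := h (coordinate_inv i))).
  by rewrite pr_y1 ?Di.
have [z1 yz1] := choice y1_unit.
have [f1 [f1C f1X]] := poly_rmorph_exists g y1.
have [f1' [f1'C f1'X]] := poly_rmorph_exists g z1.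
have f1K a : f1 'X_[a] * f1' 'X_[a] = 1.
  rewrite monomialE !rmorph_prod -big_split big1 //= => i _.
  by rewrite !rmorphXn /= f1X f1'X -exprMn yz1 expr1n.
pose y i := if D i then f1 (G' i) * f1' 'X_[A i] else y1 i.
have yD i : ~~ D i -> y i = y1 i by rewrite /y => /negbTE->.
have pr_f1 p : (forall m d, m \in msupp p -> D d -> m (enum_rank d) = 0%N) ->
    pr (f1 p) = h (scheme_poly p).
  pose u : {rmorphism S -> C'} := pr \o f1.
  pose v : {rmorphism S -> C'} := h \o scheme_poly.
  move=> pD; apply: (@rmorph_free_eq _ u v) pD => [c|i Di].
    by rewrite /u /v /= f1C -hg -scheme_polyC.
  by rewrite /u /v /= f1X pr_y1 // -scheme_polyX.
have pr_y i : pr (y i) = h (coordinate i).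
  case Di: (D i); last by rewrite yD ?Di // pr_y1 ?Di.
  rewrite /y Di rmorphM pr_f1; last by move=> m d mG Dd; apply: G'D mG.
  rewrite -scheme_relation // rmorphM -pr_f1; last exact: A_free.
  by rewrite mulrAC -rmorphM f1K rmorph1 mul1r.
(* A dependent [y i] is a unit because it lifts the unit [h (coordinate i)]. *)
have y_unit i : exists z, y i * z = 1.
  apply: (unit_of_unit_mod_square_zero surj sq (c := h (coordinate_inv i))).
  by rewrite pr_y.
have [z yz] := choice y_unit.
have y0 : y i0 = 1 by rewrite yD // /y1 (negbTE i0D) eqxx.
have [|l [lC lX]] := scheme_lift (g := g) yz y0.
  move=> f fC fX d Dd; have ff1 p :
      (forall m d, m \in msupp p -> D d -> m (enum_rank d) = 0%N) -> f p = f1 p.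
    by apply: rmorph_free_eq => [c|i Di]; rewrite ?fC ?f1C // fX yD // f1X.
  rewrite ff1; last exact: A_free.
  rewrite ff1; last by move=> m d' mG Dd'; apply: G'D mG.
  by rewrite /y Dd mulrCA f1K mulr1.
exists l; split=> // b; pose prl : {rmorphism B -> C'} := pr \o l.
apply: (@scheme_rmorph_eq _ prl h) => [c|i]; rewrite /prl /=.
  by rewrite lC hg.
by rewrite lX pr_y.
Qed.

(** The generators are [Y i] for q_i / q_i0 and [Z i] for its inverse, and [F] collects Y_i0 = 1,
    Y_i Z_i = 1 and the initial relations. That there are no further relations follows from the
    inverse map given by [scheme_lift]. *)
Lemma chart_finitely_presented : finitely_presented (torus_structure J).
Proof.
pose N := #|{: E * bool}|.
pose Y i : {mpoly k[N]} := 'X_(enum_rank (i, true)).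
pose Z i : {mpoly k[N]} := 'X_(enum_rank (i, false)).
have [fY [fYC fYX]] := poly_rmorph_exists (@mpolyC N k) Y.
pose F := [:: Y i0 - 1] ++ [seq Y i * Z i - 1 | i <- enum E]
  ++ [seq fY 'X_[A d] * Y d - fY (G' d) | d <- enum D].
have [ev [evC evX]] := @poly_rmorph_exists k (E * bool)%type B (torus_structure J)
  (fun p => if p.2 then coordinate p.1 else coordinate_inv p.1).
exists N, ev, F.
have evY i : ev (Y i) = coordinate i by rewrite evX.
have evZ i : ev (Z i) = coordinate_inv i by rewrite evX.
have ev_fY p : ev (fY p) = scheme_poly p.
  pose u : {rmorphism S -> B} := ev \o fY.
  apply: (@poly_rmorph_eq _ _ _ u scheme_poly) => [c|i]; rewrite /u /=.
    by rewrite fYC evC -scheme_polyC.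
  by rewrite fYX evY -scheme_polyX.
have evF p : p \in F -> ev p = 0.
  rewrite !mem_cat inE => /orP[/eqP->|/orP[]/mapP[i]].
  - by rewrite rmorphB evY coordinate0 rmorph1 subrr.
  - by move=> _ ->; rewrite rmorphB rmorphM evY evZ coordinateK rmorph1 subrr.
  - rewrite mem_enum => Di ->; rewrite rmorphB rmorphM !ev_fY evY.
    by rewrite scheme_relation // subrr.
split=> // [b|p].
  have [x ->] := quot_map_surj b.
  have [f [a [_ xa]]] := torus_fraction i0 x.
  have [fZ [fZC fZX]] := poly_rmorph_exists (@mpolyC N k) Z.
  have xa' : quot_map J0 x * scheme_poly 'X_[a] = scheme_poly f.
    by rewrite /scheme_poly /= -rmorphM xa.
  have YZ1 : ev (fY 'X_[a]) * ev (fZ 'X_[a]) = 1.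
    rewrite monomialE !rmorph_prod -big_split big1 //= => i _.
    by rewrite !rmorphXn /= fYX fZX evY evZ -exprMn coordinateK expr1n.
  exists (fY f * fZ 'X_[a]).
  by rewrite (rmorphM ev) ev_fY -xa' -mulrA -ev_fY YZ1 mulr1.
split; last exact: gen_ideal_rmorph0.
pose Q := gen_ideal (fun f => f \in F).
have QF q q' : q - q' \in F -> quot_map Q q = quot_map Q q'.
  by move=> Fq; apply/quot_map_eq/mem_gen_ideal.
have QYZ i : quot_map Q (Y i) * quot_map Q (Z i) = 1.
  rewrite -rmorphM -(rmorph1 (quot_map Q)); apply: QF.
  by rewrite !mem_cat (map_f (fun i => Y i * Z i - 1)) ?orbT // mem_enum.
have QY0 : quot_map Q (Y i0) = 1.
  by rewrite -(rmorph1 (quot_map Q)); apply: QF; rewrite mem_cat inE eqxx.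
pose g : {rmorphism k -> quotient_ring Q} := quot_map Q \o @mpolyC N k.
have [|l [lC lX]] := scheme_lift (g := g) QYZ QY0.
  move=> f fC fX d Dd; have ff1 q : f q = quot_map Q (fY q).
    pose u : {rmorphism S -> quotient_ring Q} := quot_map Q \o fY.
    apply: (@poly_rmorph_eq _ _ _ f u) => [c|i]; rewrite /u /=.
      by rewrite fC fYC.
    by rewrite fX fYX.
  rewrite !ff1 -rmorphM; apply: QF.
  by rewrite !mem_cat (map_f (fun d => fY 'X_[A d] * Y d - fY (G' d))) ?orbT // mem_enum.
(* [l] undoes [ev] modulo [F]; on the [Z i] this is forced, since they are inverse to the [Y i]. *)
have lev : l (ev p) = quot_map Q p.
  pose u : {rmorphism {mpoly k[N]} -> quotient_ring Q} := l \o ev.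
  apply: (@poly_rmorph_eq k (E * bool)%type _ u (quot_map Q)) => [c|[i b]]; rewrite /u /=.
    by rewrite evC lC.
  case: b; first by rewrite evY lX.
  rewrite evZ -[LHS]mul1r -(QYZ i) mulrAC [X in X * _]mulrC -lX -rmorphM.
  by rewrite mulrC [_ * coordinate i]mulrC coordinateK rmorph1 mulr1.
by move=> evp; apply/quot_map_eq0; rewrite -lev evp rmorph0.
Qed.

Theorem chart_smooth_irreducible :
  smooth (torus_structure J) /\ spec_irreducible (torus_scheme J).
Proof.
split; last exact: chart_irreducible.
by split; [apply: chart_formally_smooth|apply: chart_finitely_presented].
Qed.

End Chart.
(** * The spinor ideal *)

Section SpinorIdeal.
Variables (k : closedFieldType) (n : nat).
Local Notation E := (spinor_index n : finType).
Local Notation S := {mpoly k[#|E|]}.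
Local Notation I := (spinor_ideal k n).

Lemma Pfaffian_size0 (m : nat) (M : 'M[k]_m) : m = 0%N -> Pfaffian M = 1.
Proof.
move=> m0; subst m; rewrite /Pfaffian /= expn0 mul1n fact0 invr1 mul1r.
rewrite (bigD1 1%g) //= odd_perm1 expr0 mul1r.
rewrite [X in X + _]big1 => [|[[]] //].
by rewrite big1 ?addr0 // => s /eqP[]; apply/permP; case.
Qed.

Lemma full_set_proof : ~~ odd (n - #|[set: 'I_n]|).
Proof. by rewrite cardsT card_ord subnn. Qed.

(** Its coordinate is the Pfaffian of the empty matrix; being 1, it makes every Pfaffian point a
    point of projective space. *)
Definition full_index : E := 
  exist (fun lam : {set 'I_n} => ~~ odd (n - #|lam|)) [set: 'I_n] full_set_proof.

Lemma pfaffian_full X : pfaffian_point X full_index = 1 :> k.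
Proof. by apply: Pfaffian_size0; rewrite setCT cards0. Qed.

Lemma eval_at_scale (c : k) (y : E -> k) (f : S) d : f \is d.-homog ->
  eval_at (fun i => c * y i) f = c ^+ d * eval_at y f.
Proof.
move=> /dhomogP fd; rewrite /eval_at !mevalE mulr_sumr big_seq [RHS]big_seq.
apply: eq_bigr => m mf; have <- : mdeg m = d by apply: fd.
rewrite mulrCA; congr (_ * _).
by rewrite mdegE -prodrXr -big_split; apply: eq_bigr => i _; rewrite exprMn.
Qed.

(** The generators of the ideal are homogeneous, so they vanish on the whole cone over the Pfaffian
    points. *)
Lemma spinor_ideal_eval (f : S) (X : 'M[k]_n) (c : k) : I f -> X^T = - X ->
  eval_at (fun i => c * pfaffian_point X i) f = 0.
Proof.
move=> If Xskew.
pose ev : {rmorphism S -> k} := meval (fun j => c * pfaffian_point X (enum_val j)).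
apply: (gen_ideal_rmorph0 (f := ev) _ If) => g [[d gd] gX].
have -> : ev g = eval_at (fun i => c * pfaffian_point X i) g by [].
rewrite (eval_at_scale _ _ gd) gX ?mulr0 //; split.
  by exists full_index; rewrite pfaffian_full oner_neq0.
by move=> h _; apply; exists X.
Qed.

(** By definition of the closure, a form vanishing at the Pfaffian points vanishes on the spinor
    variety. *)
Lemma spinor_ideal_mem (f : S) d : f \is d.-homog ->
    (forall X : 'M[k]_n, X^T = - X -> eval_at (pfaffian_point X) f = 0) ->
  I f.
Proof.
move=> fd fX; apply: mem_gen_ideal; split; first by exists d.
move=> x [_ xY]; apply: xY => [|y [X Xskew ->]]; first by exists d.
exact: fX.
Qed.

End SpinorIdeal.

(* A subset of [n] is encoded by its indicator sequence. *)
Definition valid (n : nat) (b : seq bool) := (size b == n) && ~~ odd (n - count id b).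

Section Codes.
Variable n : nat.
Local Notation E := (spinor_index n : finType).

(** Sequences giving a subset of the wrong parity are sent to [full_index]; results about
    [code_index] assume [valid]. *)
Definition code_index (b : seq bool) : E :=
  insubd (full_index n) [set i : 'I_n | nth false b i].

Definition index_code (e : E) : seq bool := [seq i \in val e | i <- enum 'I_n].

Lemma card_code_set b : size b = n -> #|[set i : 'I_n | nth false b i]| = count id b.
Proof.
by move=> <-; rewrite -sum1dep_card -sum1_count (big_nth false) big_mkord.
Qed.

Lemma code_indexE b : valid n b ->
  val (code_index b) = [set i : 'I_n | nth false b i].
Proof.
by move=> /andP[/eqP bn bp]; rewrite /code_index val_insubd card_code_set // bp.
Qed.

Lemma code_indexK b : valid n b -> index_code (code_index b) = b.
Proof.
move=> bv; have /andP[/eqP bn _] := bv; rewrite /index_code code_indexE //.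
rewrite -[RHS](mkseq_nth false b) /mkseq bn -val_enum_ord -map_comp.
by apply: eq_map => i /=; rewrite inE.
Qed.

Lemma index_codeK e : code_index (index_code e) = e.
Proof.
apply: val_inj; have setE : [set i : 'I_n | nth false (index_code e) i] = val e.
  apply/setP => i; rewrite inE (nth_map i) ?size_enum_ord //.
  by rewrite nth_ord_enum.
by rewrite /code_index setE /insubd valK.
Qed.

Lemma index_code_valid e : valid n (index_code e).
Proof.
have sz : size (index_code e) = n by rewrite size_map size_enum_ord.
rewrite /valid sz eqxx -card_code_set //; have := valP e.
rewrite -{1}[e]index_codeK; congr (~~ odd (_ - _)).
congr #|pred_of_set _|; apply/setP => i.
rewrite inE (nth_map i) ?size_enum_ord // nth_ord_enum.
by rewrite index_codeK.
Qed.

End Codes.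
(* An entry [(d, (a, ts))] encodes the relation
   [prod_(b in a) q_b * q_d = sum_((s, t) in ts) (-1)^s prod_(b in t) q_b]. *)
Definition entry := (seq bool * (seq (seq bool) * seq (bool * seq (seq bool))))%type.

Definition heads (C : seq entry) := [seq e.1 | e <- C].

(** The side conditions of a chart in boolean form, so that concrete charts are checked by
    computation: [b0] is free, heads are distinct and occur in no other monomial, and relations are
    homogeneous. *)
Definition wf_chart (n : nat) (b0 : seq bool) (C : seq entry) : bool :=
  let ok l := all (valid n) l && all [predC heads C] l in
  [&& valid n b0, b0 \notin heads C, uniq (heads C) &
      all (fun e => [&& valid n e.1, ok e.2.1 &
        all (fun t => (size t.2 == (size e.2.1).+1) && ok t.2) e.2.2]) C].

Definition entry_rel (k : fieldType) (y : seq bool -> k) (e : entry) : Prop :=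
  \prod_(b <- e.2.1) y b * y e.1 =
  \sum_(t <- e.2.2) (-1) ^+ nat_of_bool t.1 * \prod_(b <- t.2) y b.

Definition entry_weight (R : numDomainType) (W : seq bool -> R) (e : entry) : Prop :=
  forall t, t \in e.2.2 -> \sum_(b <- e.2.1) W b + W e.1 <= \sum_(b <- t.2) W b.

(** * Charts given by lists of relations *)

Section CodeChart.
Variables (k : closedFieldType) (R : realType) (n : nat) (w : spinor_index n -> R).
Local Notation E := (spinor_index n : finType).
Local Notation S := {mpoly k[#|E|]}.
Local Notation I := (spinor_ideal k n).
Local Notation var i := ('X_(enum_rank (i : E)) : S).

Definition code_monomial (l : seq (seq bool)) : 'X_{1..#|E|} :=
  (\sum_(b <- l) U_(enum_rank (code_index n b : E)))%MM.

Lemma weight_code_monomial l :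
  weight w (code_monomial l) = \sum_(b <- l) w (code_index n b).
Proof.
rewrite /code_monomial; elim: l => [|b l IHl]; first by rewrite !big_nil weight0.
by rewrite !big_cons weightD IHl weight_var.
Qed.

Lemma mdeg_code_monomial l : mdeg (code_monomial l) = size l.
Proof.
rewrite /code_monomial; elim: l => [|b l IHl]; first by rewrite big_nil mdeg0.
by rewrite big_cons mdegD IHl mdeg1.
Qed.

Lemma eval_code_monomial (y : E -> k) l :
  eval_at y 'X_[code_monomial l] = \prod_(b <- l) y (code_index n b).
Proof.
rewrite /code_monomial /eval_at; elim: l => [|b l IHl].
  by rewrite !big_nil mpolyX0 rmorph1.
by rewrite !big_cons mpolyXD rmorphM /= IHl mevalXU enum_rankK.
Qed.

Lemma code_monomial_free l (d : E) : all (valid n) l -> index_code d \notin l ->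
  code_monomial l (enum_rank d) = 0%N.
Proof.
rewrite /code_monomial; elim: l => [|b l IHl] /=; first by rewrite big_nil mnm0E.
move=> /andP[bv lv]; rewrite inE negb_or big_cons mnmDE => /andP[db dl].
rewrite IHl // mnm1E (inj_eq enum_rank_inj); case: eqP => // bd.
by rewrite -bd code_indexK // eqxx in db.
Qed.

Definition term_poly (ts : seq (bool * seq (seq bool))) : S :=
  \sum_(t <- ts) (-1) ^+ nat_of_bool t.1 *: 'X_[code_monomial t.2].

Lemma msupp_term_poly ts m : m \in msupp (term_poly ts) ->
  exists2 t, t \in ts & m = code_monomial t.2.
Proof.
rewrite /term_poly; elim: ts => [|t ts IHts]; first by rewrite big_nil msupp0.
rewrite big_cons => /msuppD_le; rewrite mem_cat => /orP[/msuppZ_le|/IHts[u uts ->]].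
  by rewrite msuppX inE => /eqP->; exists t; rewrite ?mem_head.
by exists u; rewrite ?inE ?uts ?orbT.
Qed.

Lemma eval_term_poly (y : E -> k) ts : eval_at y (term_poly ts) =
  \sum_(t <- ts) (-1) ^+ nat_of_bool t.1 * \prod_(b <- t.2) y (code_index n b).
Proof.
rewrite /term_poly /eval_at rmorph_sum; apply: eq_bigr => t _ /=.
by rewrite mevalZ -/(eval_at y _) eval_code_monomial.
Qed.

(** The chart theorem for relations given as lists. The condition on [y] puts torus points
    satisfying the relations on the cone over the Pfaffian points, where the spinor ideal
    vanishes. *)
Theorem code_chart (b0 : seq bool) (C : seq entry) :
    wf_chart n b0 C ->
    (forall (X : 'M[k]_n) e, X^T = - X -> e \in C ->
       entry_rel (fun b => pfaffian_point X (code_index n b)) e) ->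
    (forall y : seq bool -> k, (forall b, valid n b -> y b != 0) ->
       (forall e, e \in C -> entry_rel y e) ->
       exists (X : 'M[k]_n) (c : k), X^T = - X /\
         forall b, valid n b -> y b = c * pfaffian_point X (code_index n b)) ->
    (forall e, e \in C -> entry_weight (fun b => w (code_index n b)) e) ->
    in_trop w I ->
  smooth (torus_structure (initial_ideal w I)) /\
  spec_irreducible (torus_scheme (initial_ideal w I)).
Proof.
move=> /and4P[b0v b0C uC /allP wfC] relC vanC wtC.
pose D : pred E := fun d => index_code d \in heads C.
pose lookup (d : E) := nth ([::], ([::], [::])) C (index (index_code d) (heads C)).
have lookupP d : D d -> lookup d \in C /\ (lookup d).1 = index_code d.
  move=> Dd; have lt : (index (index_code d) (heads C) < size C)%N.
    by rewrite -(size_map fst) index_mem.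
  by split; [apply: mem_nth|rewrite -(nth_map _ [::]) // nth_index].
have ok_free l d : all (valid n) l && all [predC heads C] l -> D d ->
    code_monomial l (enum_rank d) = 0%N.
  move=> /andP[lv /allP lC] Dd; apply: code_monomial_free => //.
  by apply/negP => /lC /=; rewrite -/(D d) Dd.
pose A d := code_monomial (lookup d).2.1.
pose G d := term_poly (lookup d).2.2.
have lookup_ok d : D d -> let e := lookup d in
    [/\ all (valid n) e.2.1 && all [predC heads C] e.2.1 &
     forall t, t \in e.2.2 -> size t.2 = (size e.2.1).+1 /\
       all (valid n) t.2 && all [predC heads C] t.2].
  move=> /lookupP[/wfC /and3P[_ ea /allP ets] _]; split=> // t /ets.
  by move=> /andP[/eqP-> ->].
have G_homog d : D d -> G d \is (mdeg (A d)).+1.-homog.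
  move=> Dd; apply/dhomogP => m /msupp_term_poly[t te ->].
  by have [_ /(_ t te)[st _]] := lookup_ok d Dd; rewrite /= !mdeg_code_monomial st.
have eval_rel (y : E -> k) d : D d -> eval_at y ('X_[A d] * var d - G d) = 0 <->
    entry_rel (fun b => y (code_index n b)) (lookup d).
  move=> Dd; rewrite /entry_rel (lookupP d Dd).2 index_codeK -eval_term_poly.
  rewrite -eval_code_monomial /eval_at mevalB mevalM mevalXU enum_rankK.
  by split=> [/eqP|->]; [rewrite subr_eq0 => /eqP|rewrite subrr].
apply: (@chart_smooth_irreducible k E R w I (code_index n b0) D A G).
- by rewrite /D code_indexK.
- by move=> d d' Dd Dd'; apply: ok_free Dd'; have [] := lookup_ok d Dd.
- move=> d d' m Dd Dd' /msupp_term_poly[t te ->]; apply: ok_free Dd'.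
  by have [_ /(_ t te)[]] := lookup_ok d Dd.
- exact: G_homog.
- move=> d Dd; apply: (@spinor_ideal_mem k n _ (mdeg (A d)).+1).
    apply: rpredB; last exact: G_homog.
    by rewrite -mpolyXD dhomogX /= mdegD mdeg1 addn1.
  move=> X Xskew; apply/eval_rel => //; apply: relC => //.
  by have [] := lookupP d Dd.
- move=> d m Dd /msupp_term_poly[t te ->]; rewrite !weight_code_monomial.
  have [eC ed] := lookupP d Dd; have := wtC _ eC t te.
  by rewrite ed index_codeK.
- move=> y y0 yD f If.
  have [||X [c [Xskew yX]]] := vanC (fun b => y (code_index n b)).
  + by move=> b _; apply: y0.
  + move=> e eC.
    have [ev _ _] := and3P (wfC e eC).
    have De : D (code_index n e.1) by rewrite /D code_indexK // map_f.
    (* The heads are distinct, so looking up the head of [e] finds [e] itself. *)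
    suff le : lookup (code_index n e.1) = e.
      by have := (eval_rel y _ De).1 (yD _ De); rewrite le.
    have eC' : (index e C < size (heads C))%N by rewrite size_map index_mem.
    rewrite /lookup code_indexK // -{1}(nth_index e eC) -(nth_map _ [::]) ?index_mem //.
    by rewrite index_uniq // (set_nth_default e) ?nth_index ?index_mem.
  rewrite -(spinor_ideal_eval c If Xskew); apply: meval_eq => j.
  by rewrite -{1}[enum_val j]index_codeK yX ?index_code_valid // index_codeK.
Qed.

(** If the monomial of [e] were strictly lighter than all other terms, it would be, up to sign, an
    initial form of the ideal, and a monomial is a unit in the Laurent ring. *)
Lemma trop_edge (e : seq (seq bool)) (s : bool) (ts : seq (bool * seq (seq bool))) :
    (forall t, t \in ts -> size t.2 = size e) ->
    (forall X : 'M[k]_n, X^T = - X ->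
       let y b := pfaffian_point X (code_index n b) in
       (-1) ^+ nat_of_bool s * \prod_(b <- e) y b +
       \sum_(t <- ts) (-1) ^+ nat_of_bool t.1 * \prod_(b <- t.2) y b = 0) ->
    in_trop w I ->
  exists2 t, t \in ts &
    \sum_(b <- t.2) w (code_index n b) <= \sum_(b <- e) w (code_index n b).
Proof.
move=> szt fX trop; apply: contrapT => no_t.
have lt_t t : t \in ts ->
    weight w (code_monomial e) < weight w (code_monomial t.2).
  move=> tts; rewrite !weight_code_monomial ltNge; apply/negP => le_t.
  by apply: no_t; exists t.
pose f := (-1) ^+ nat_of_bool s *: 'X_[code_monomial e] + term_poly ts : S.
have f_homog : f \is (size e).-homog.
  apply: rpredD; first by rewrite rpredZ // dhomogX /= mdeg_code_monomial.
  by apply/dhomogP => m /msupp_term_poly[t te ->]; rewrite /= mdeg_code_monomial szt.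
have If : I f.
  apply: (spinor_ideal_mem f_homog) => X Xskew; rewrite /eval_at mevalD mevalZ.
  by rewrite -!/(eval_at _ _) eval_code_monomial eval_term_poly fX.
set m0 := code_monomial e in lt_t f f_homog If.
have m0ts : m0 \notin msupp (term_poly ts).
  by apply/negP => /msupp_term_poly[t /lt_t + m0E]; rewrite -m0E ltxx.
have fm0 : f@_m0 = (-1) ^+ nat_of_bool s.
  by rewrite mcoeffD mcoeffZ mcoeffX eqxx mulr1 (memN_msupp_eq0 m0ts) addr0.
have m0f : m0 \in msupp f by rewrite mcoeff_msupp fm0 signr_eq0.
have f_init : initial_form w f = (-1) ^+ nat_of_bool s *: 'X_[m0].
  rewrite (initial_formE m0f erefl) => [|m /msuppD_le]; last first.
    rewrite mem_cat => /orP[/msuppZ_le|/msupp_term_poly[t /lt_t/ltW + ->]] //.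
    by rewrite msuppX inE => /eqP->.
  apply/mpolyP => m; rewrite mcoeff_weight_part mcoeffZ mcoeffX.
  case: (m0 =P m) => [<-|m0m]; first by rewrite eqxx fm0 mulr1.
  rewrite mulr0; case: eqP => // mw; rewrite mcoeffD mcoeffZ mcoeffX.
  rewrite (introF eqP m0m) mulr0 add0r; apply: memN_msupp_eq0.
  by apply/negP => /msupp_term_poly[t /lt_t + mE]; rewrite -mE mw ltxx.
apply: trop.
pose sgn := poly_to_laurent ((-1) ^+ nat_of_bool s)%:MP : laurent k E.
have -> : 1 = (sgn * monomial_inv m0) * poly_to_laurent ((-1) ^+ nat_of_bool s *: 'X_[m0]).
  rewrite -mul_mpolyC rmorphM mulrACA [_ * poly_to_laurent 'X_[_]]mulrC monomial_invK.
  by rewrite mulr1 -rmorphM -rmorphM -signr_addb addbb rmorph1.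
apply/idealM/mem_gen_ideal; exists (initial_form w f); last by rewrite f_init.
by apply: mem_gen_ideal; exists f.
Qed.

End CodeChart.
(** * Pfaffians of size at most four *)

Section AlternatingSum.
Variable K : comNzRingType.

(** A signed sum over permutations, written as lists of values and expanded by the first value [j];
    [bump j] relabels the remaining values to avoid [j]. It unfolds by computation, unlike a sum
    over ['S_n]. *)
Fixpoint altsum (n : nat) (h : seq nat -> K) : K :=
  if n is n'.+1 then
    \sum_(j <- iota 0 n) (-1) ^+ j * altsum n' (fun l => h (j :: map (bump j) l))
  else h [::].

Lemma perm_sum_lift n (F : 'S_n.+1 -> K) :
  \sum_s F s = \sum_j \sum_s F (lift_perm ord0 j s).
Proof.
pose f (p : 'I_n.+1 * 'S_n) := lift_perm ord0 p.1 p.2.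
have f_inj : injective f.
  move=> [i s] [j t] /= st; have /esym ij : i = j.
    by rewrite -(lift_perm_id ord0 i s) -(lift_perm_id ord0 j t) [lift_perm _ _ _]st.
  subst j; congr (_, _); apply/permP => l; apply: (@lift_inj _ i).
  by rewrite -!(lift_perm_lift ord0) [lift_perm _ _ _]st.
have f_bij : bijective f.
  by apply: inj_card_bij; rewrite ?card_prod ?card_Sn ?card_ord -?factS.
by rewrite pair_big (reindex f) //; apply: onW_bij.
Qed.

(** Induction by splitting off the image [j] of 0, which contributes the sign (-1)^j. *)
Lemma perm_sum_altsum n (h : seq nat -> K) :
  \sum_(s : 'S_n) (-1) ^+ nat_of_bool s * h [seq val (s i) | i <- enum 'I_n] =
  altsum n h.
Proof.
elim: n h => [|n IHn] h /=.
  rewrite (bigD1 1%g) //= odd_perm1 expr0 mul1r enum_ord0 /=.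
  by rewrite big1 ?addr0 // => s /eqP[]; apply/permP; case.
rewrite perm_sum_lift -[0%N :: iota 1 n]/(iota 0 n.+1) -val_enum_ord big_map big_enum.
apply: eq_bigr => j _; rewrite -IHn mulr_sumr; apply: eq_bigr => s _.
rewrite odd_lift_perm /= signr_addb mulrA signr_odd; congr (_ * h _).
rewrite enum_ordSl /= lift_perm_id; congr (_ :: _).
by rewrite -!map_comp; apply: eq_map => i /=; rewrite lift_perm_lift.
Qed.

End AlternatingSum.

Lemma nth_perm_values n (u : 'S_n.+1) i : (i < n.+1)%N ->
  nth 0%N [seq val (u j) | j <- enum 'I_n.+1] i = u (inord i).
Proof.
move=> ltin; rewrite (nth_map (inord 0)) ?size_enum_ord //; congr (val (u _)).
by apply: val_inj; rewrite /= nth_enum_ord // inordK.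
Qed.

Section SmallPfaffians.
Variables (k : fieldType).
Hypothesis char0 : [pchar k] =i pred0.

Lemma natr_neq0 m : (0 < m)%N -> m%:R != 0 :> k.
Proof. by rewrite lt0n ((pcharf0P k).1 char0). Qed.

(** Only sizes 0, 2 and 4 occur for n at most 5; the value 0 at other sizes is a filler. *)
Definition pf_value (x : nat -> nat -> k) (s : seq nat) : k :=
  match s with
  | [::] => 1
  | [:: i; j] => x i j
  | [:: i; j; l; m] => x i j * x l m - x i l * x j m + x i m * x j l
  | _ => 0
  end.

Lemma pf_value2 (x : nat -> nat -> k) s : size s = 2 ->
  pf_value x s = x (nth 0%N s 0) (nth 0%N s 1).
Proof. by case: s => [|? [|? []]]. Qed.

Lemma pf_value4 (x : nat -> nat -> k) s (y := fun i j => x (nth 0%N s i) (nth 0%N s j)) :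
  size s = 4 -> 
  pf_value x s = y 0%N 1%N * y 2%N 3%N - y 0%N 2%N * y 1%N 3%N + y 0%N 3%N * y 1%N 2%N.
Proof. by rewrite /y; case: s y => [|? [|? [|? [|? []]]]]. Qed.

Variables (x : nat -> nat -> k) (s : seq nat) (m : nat) (M : 'M[k]_m).
Hypothesis x_skew : forall i j, x i j = - x j i.
Hypothesis ms : m = size s.
Hypothesis Mx : forall i j : 'I_m, M i j = x (nth 0%N s i) (nth 0%N s j).

Lemma Pfaffian2 : size s = 2 -> Pfaffian M = pf_value x s.
Proof.
move=> s2; rewrite pf_value2 //; move: M Mx; rewrite ms s2 => N Nx.
pose y i j := x (nth 0%N s i) (nth 0%N s j).
rewrite /Pfaffian; transitivity ((2 ^ 2./2 * (2./2)`!)%:R^-1 *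
    altsum 2 (fun l => y (nth 0%N l 0) (nth 0%N l 1))).
  congr (_ * _); rewrite -perm_sum_altsum; apply: eq_bigr => u _; congr (_ * _).
  rewrite (bigD1 (inord 0, inord 1)) /=; last by rewrite !inordK.
  rewrite big1 => [|[i j] /=]; last first.
    case: i j => [[|[]] // ? [[|[]] // ?]] /andP[/andP[_ _]].
    by case/eqP; congr pair; apply: val_inj; rewrite /= inordK.
  by rewrite mulr1 Nx !nth_perm_values.
rewrite /= !(big_cons, big_nil) /= /bump /=.
have -> : (2 ^ 1 * 1`!)%:R = 2 :> k by [].
have yskew : y 1%N 0%N = - y 0%N 1%N by apply: x_skew.
by rewrite !(add0n, add1n) yskew -[x _ _]/(y 0%N 1%N); field; apply: (natr_neq0 (m := 2)).
Qed.

(** The product runs over the pairs (0,1) and (2,3). Each of the three perfect matchings arises from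
    8 permutations with equal signed contributions, and 8 is the normalizing factor. *)
Lemma Pfaffian4 : size s = 4 -> Pfaffian M = pf_value x s.
Proof.
move=> s4; rewrite pf_value4 //; move: M Mx; rewrite ms s4 => N Nx.
pose y i j := x (nth 0%N s i) (nth 0%N s j).
rewrite /Pfaffian; transitivity ((2 ^ 4./2 * (4./2)`!)%:R^-1 *
    altsum 4 (fun l => y (nth 0%N l 0) (nth 0%N l 1) * y (nth 0%N l 2) (nth 0%N l 3))).
  congr (_ * _); rewrite -perm_sum_altsum; apply: eq_bigr => u _; congr (_ * _).
  rewrite (bigD1 (inord 0, inord 1)) /=; last by rewrite !inordK.
  rewrite (bigD1 (inord 2, inord 3)) /=; last first.
    by rewrite !inordK //= xpair_eqE -val_eqE /= !inordK.
  rewrite big1 => [|[i j] /=]; last first.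
    move=> /andP[/andP[/andP[+ +] +] +].
    case: i j => [[|[|[|[|?]]]] ?] [[|[|[|[|?]]]] ?] //= _ _ ne1 ne2.
      by case/negP: ne1; rewrite xpair_eqE -!val_eqE /= !inordK.
    by case/negP: ne2; rewrite xpair_eqE -!val_eqE /= !inordK.
  by rewrite mulr1 !Nx !nth_perm_values.
rewrite /= !(big_cons, big_nil) /= /bump /=.
have -> : (2 ^ 2 * 2`!)%:R = 8 :> k by [].
have yskew i j : y i j = - y j i by apply: x_skew.
rewrite !(add0n, add1n) (yskew 1%N 0%N) (yskew 2%N 0%N) (yskew 3%N 0%N)
  (yskew 2%N 1%N) (yskew 3%N 1%N) (yskew 3%N 2%N).
rewrite -[X in _ = X]/(y 0%N 1%N * y 2%N 3%N - y 0%N 2%N * y 1%N 3%N + y 0%N 3%N * y 1%N 2%N).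
by field; apply: (natr_neq0 (m := 8)).
Qed.

End SmallPfaffians.

(** * Pfaffian coordinates as explicit polynomials *)

Section PfaffianPoints.
Variables (k : closedFieldType) (n : nat).
Hypothesis char0 : [pchar k] =i pred0.

Definition zeros (b : seq bool) := [seq i <- iota 0 (size b) | ~~ nth false b i].

Lemma enum_code_complement b : valid n b ->
  [seq val i | i <- enum (~: val (code_index n b))] = zeros b.
Proof.
move=> bv; have /andP[/eqP bn _] := bv; rewrite code_indexE // /zeros bn.
rewrite -val_enum_ord filter_map; congr map.
rewrite [enum _]/(filter _ _) -enumT; apply: eq_filter => i /=.
by rewrite !inE.
Qed.

Lemma pfaffian_code (X : 'M[k]_n) (x : nat -> nat -> k) b :
    (forall i j : 'I_n, X i j = x i j) -> (forall i j, x i j = - x j i) ->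
    valid n b -> size (zeros b) \in [:: 0; 2; 4] ->
  pfaffian_point X (code_index n b) = pf_value x (zeros b).
Proof.
move=> Xx xskew bv sz; rewrite /pfaffian_point; set mu := ~: _.
have mus : #|mu| = size (zeros b) by rewrite -enum_code_complement // size_map cardE.
have Mx (i j : 'I_#|mu|) : principal_submatrix X mu i j =
    x (nth 0%N (zeros b) i) (nth 0%N (zeros b) j).
  rewrite mxE Xx -!enum_code_complement // -/mu.
  by rewrite !(nth_map (enum_val i)) -?cardE // -!enum_val_nth.
move: sz; rewrite !inE => /or3P[] /eqP sz.
- by rewrite Pfaffian_size0 ?mus // (size0nil sz).
- exact: Pfaffian2 sz.
- exact: Pfaffian4 sz.
Qed.

End PfaffianPoints.
(** * Bad edges in the folded 5-cube *)

Fixpoint bitseqs (n : nat) : seq bitseq :=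
  if n is n'.+1 then [seq b :: l | b <- [:: true; false], l <- bitseqs n'] else [:: [::]].

Definition codes (n : nat) := [seq b <- bitseqs n | valid n b].

Lemma mem_bitseqs n b : (b \in bitseqs n) = (size b == n).
Proof.
elim: n b => [|n IHn] b; first by case: b.
rewrite -[bitseqs n.+1]/[seq b :: l | b <- [:: true; false], l <- bitseqs n].
case: b => [|c b]; first by apply/negbTE/negP => /allpairsP[[? ?] []].
rewrite eqSS -IHn; apply/allpairsP/idP => [[[c' b'] [_ b'n [_ ->]]] //|bn].
by exists (c, b); split=> //; case: c.
Qed.

Lemma mem_codes n b : (b \in codes n) = valid n b.
Proof.
by rewrite mem_filter mem_bitseqs andb_idr // => /andP[].
Qed.

(* In the folded 5-cube on the subsets of odd size, [neighbor v i] is the complement of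
   [v] flipped at [i]; the edges [(c, neighbor c i)] with the same i-th bit are the
   monomials of one of the ten quadrics. *)
Definition neighbor (v : bitseq) (i : nat) : bitseq :=
  mkseq (fun j => nth false v j (+) (j != i)) 5.

(** For distinct directions this is [neighbor (neighbor v i) j], a vertex at distance two from
    [v]. *)
Definition flip2 (v : bitseq) (i j : nat) : bitseq :=
  mkseq (fun l => nth false v l (+) (l == i) (+) (l == j)) 5.

Definition perms5 := permutations (iota 0 5).

(** The vertices on the same side as [v] in direction [i], listed so that consecutive pairs are the
    four edges of the quadric. *)
Definition facet8 (v : bitseq) (i j k l m : nat) : seq bitseq :=
  [:: v; neighbor v i; flip2 v k l; flip2 v j m; flip2 v l m; flip2 v j k;
      flip2 v k m; flip2 v j l].

(** The incidences around [v] and [flip2 v k l] on which the weight comparisons rest, checked by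
    computation for all vertices and all orders of the directions. *)
Definition incidence (v : bitseq) (i j k l m : nat) : bool :=
  let u := flip2 v k l in
  [&& [&& u \in codes 5, nth false u i == nth false v i, nth false u j == nth false v j &
          neighbor u i == flip2 v j m],
      neighbor u j == flip2 v i m, neighbor u k == neighbor v l,
      [&& neighbor (neighbor v l) k == u, neighbor (flip2 v i k) l == flip2 v j m,
          nth false (flip2 v i k) l == nth false v l,
          neighbor (flip2 v i k) k == neighbor v i &
          neighbor (neighbor v i) k == flip2 v i k],
      [&& flip2 v i k \in codes 5, neighbor v i \in codes 5 &
          neighbor (neighbor v i) i == v] &
      [&& all (fun c => (nth false c k == nth false u k) ==>
         (c \in [:: flip2 v i k; neighbor v i; flip2 v j k; neighbor v j;
                    u; neighbor v l; flip2 v m k; neighbor v m])) (codes 5) &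
          all (fun c => (nth false c i == nth false v i) ==>
         (c \in facet8 v i j k l m)) (codes 5)]].

Lemma incidenceP : all (fun v => all (fun p =>
  if p is [:: i; j; k; l; m] then incidence v i j k l m else false) perms5) (codes 5).
Proof. by vm_compute. Qed.

#[local] Opaque codes neighbor flip2 perms5 facet8.

(** * A vertex with at most one bad edge *)

Section FewBadEdges.
Variables (R : realType) (W : bitseq -> R).

Definition edge_weight c i := W c + W (neighbor c i).

Definition good v i := all (fun c => (nth false c i == nth false v i) ==>
  (edge_weight v i <= edge_weight c i)) (codes 5).

Hypothesis trop : forall v i, v \in codes 5 -> (i < 5)%N ->
  exists2 c, c \in codes 5 & [&& nth false c i == nth false v i, c != v,
    c != neighbor v i & edge_weight c i <= edge_weight v i].

Lemma goodP v i : reflect (forall c, c \in codes 5 -> nth false c i = nth false v i ->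
  edge_weight v i <= edge_weight c i) (good v i).
Proof.
apply: (iffP allP) => [vg c cc ci|vg c cc]; last by apply/implyP => /eqP; apply: vg.
by have /implyP := vg c cc; apply; apply/eqP.
Qed.

Lemma badP v i : ~~ good v i -> exists2 c, c \in codes 5 &
  nth false c i = nth false v i /\ edge_weight c i < edge_weight v i.
Proof.
rewrite -has_predC => /hasP[c cc /=]; rewrite negb_imply -ltNge => /andP[/eqP ci cv].
by exists c.
Qed.

Section Directions.
Variables (v : bitseq) (i j k l m : nat).
Hypotheses (vc : v \in codes 5) (p5 : [:: i; j; k; l; m] \in perms5).

Lemma perms5_sym : [:: j; i; k; l; m] \in perms5 /\
  [:: m; j; k; l; i] \in perms5 /\ (i < 5)%N /\ (k < 5)%N.
Proof.
have : all (fun p => if p is [:: i; j; k; l; m] then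
    [&& [:: j; i; k; l; m] \in perms5, [:: m; j; k; l; i] \in perms5, (i < 5)%N & (k < 5)%N]
  else false) perms5 by vm_compute.
by move/allP/(_ _ p5)/and4P=> [-> -> -> ->].
Qed.

Lemma incidence_v (q : seq nat) : q \in perms5 ->
  if q is [:: i'; j'; k'; l'; m'] then incidence v i' j' k' l' m' else false.
Proof. by have /allP/(_ _ vc)/allP := incidenceP; apply. Qed.

(** Write u for [flip2 v k l]. Comparing u with v in the directions i and j, and using that v is
    good at l, the edge of u in direction k is lighter than two of the other three edges of its
    quadric. The third cannot be the only minimum, as the minimum is attained twice. *)
Lemma good_transfer : ~~ good v i -> ~~ good v j ->
  good (flip2 v k l) i -> good (flip2 v k l) j -> good v l -> good (flip2 v k l) k.
Proof.
have [p5j [p5m [_ k5]]] := perms5_sym.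
have /and5P[/and4P[uc /eqP ui /eqP uj /eqP Nui] /eqP Nuj /eqP Nuk ik /andP[]] :=
  incidence_v p5.
case/and5P: ik => /eqP Nvlk /eqP Nikl /eqP ikl /eqP Nikk /eqP Nvik.
move=> /and3P[ikc _ _] /andP[/allP side _].
have /and5P[_ _ _ /and5P[_ /eqP Njkl /eqP jkl /eqP Njkk /eqP Nvjk] /andP[/and3P[jkc _ _] _]] :=
  incidence_v p5j.
have /and5P[_ _ _ /and5P[_ _ _ /eqP Nmkk /eqP Nvmk] _] := incidence_v p5m.
move=> /badP[ci cic [cii ltci]] /badP[cj cjc [cjj ltcj]] /goodP gui /goodP guj /goodP gvl.
(* In direction i the edge of u is minimal and that of v is not, whence a strict inequality. *)
have {ci cic cii ltci} h1 : W (flip2 v k l) + W (flip2 v j m) < W v + W (neighbor v i).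
  by apply: le_lt_trans ltci; rewrite -Nui; apply: gui; rewrite // cii ui.
have {cj cjc cjj ltcj} h2 : W (flip2 v k l) + W (flip2 v i m) < W v + W (neighbor v j).
  by apply: le_lt_trans ltcj; rewrite -Nuj; apply: guj; rewrite // cjj uj.
have h3 := gvl _ ikc ikl; have h4 := gvl _ jkc jkl.
rewrite /edge_weight Nikl in h3; rewrite /edge_weight Njkl in h4.
(* [h1] with [h3], and [h2] with [h4], compare the edge of u in direction k with those through
   [flip2 v i k] and [flip2 v j k]; only the edge through [flip2 v m k] is left open. *)
have far c : c \in codes 5 -> nth false c k = nth false (flip2 v k l) k ->
    c != flip2 v m k -> c != neighbor v m ->
    edge_weight (flip2 v k l) k <= edge_weight c k.
  move=> cc ck cm cNm; have /implyP := side c cc; rewrite ck eqxx => /(_ isT).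
  rewrite !inE (negbTE cm) (negbTE cNm) !orbF.
  move=> /or4P[/eqP->|/eqP->|/eqP->|/or3P[/eqP->|/eqP->|/eqP->]];
    rewrite /edge_weight ?Nuk ?Nikk ?Nvik ?Njkk ?Nvjk ?Nvlk; lra.
apply/goodP => c cc ck; rewrite leNgt; apply/negP => ltc.
have {}cm : (c == flip2 v m k) || (c == neighbor v m).
  apply/negPn/negP; rewrite negb_or => /andP[cm cNm].
  by have := far c cc ck cm cNm; rewrite leNgt ltc.
(* [c] is on the open edge; the tropical condition gives another edge that is no heavier, to which
   [far] applies. *)
have [c' c'c /and4P[/eqP c'k c'1 c'2 c'w]] := trop cc k5.
have := far c' c'c; rewrite c'k => /(_ ck).
have [-> ->] : c' != flip2 v m k /\ c' != neighbor v m.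
  by case/orP: cm c'1 c'2 => /eqP->; rewrite ?Nmkk ?Nvmk => -> ->.
by move=> /(_ isT isT); rewrite leNgt (le_lt_trans c'w ltc).
Qed.

(** The minimum over the four edges is attained twice, but not at v. So at least two of the edges
    through [flip2 v k l], [flip2 v l m] and [flip2 v k m] are minimal, hence one of the first
    two. *)
Lemma good_choice : ~~ good v i -> good (flip2 v k l) i || good (flip2 v l m) i.
Proof.
have [_ [_ [i5 _]]] := perms5_sym.
have /and5P[_ _ _ _ /andP[/and3P[_ Nvc /eqP NNv] /andP[_ /allP side]]] := incidence_v p5.
have [|e + emin] :=
    @seq_argmin R _ (edge_weight^~ i) [seq c <- codes 5 | nth false c i == nth false v i].
  by rewrite -has_filter; apply/hasP; exists v.
rewrite mem_filter => /andP[/eqP ei ec].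
have min_good c : c \in codes 5 -> nth false c i = nth false v i ->
    edge_weight c i <= edge_weight e i -> good c i.
  move=> cc ci ce; apply/goodP => c' c'c c'i; apply: (le_trans ce).
  by apply: emin; rewrite mem_filter c'c c'i ci eqxx.
move=> vb; apply/negPn/negP; rewrite negb_or => /andP[klb lmb].
have : all (fun p => if p is [:: i; j; k; l; m] then all (mem perms5)
    [:: [:: i; j; k; m; l]; [:: i; k; j; l; m]; [:: i; k; j; m; l];
        [:: i; l; j; k; m]; [:: i; j; l; m; k]] else false) perms5.
  by clear; vm_compute.
move/allP/(_ _ p5)/and5P=> [/incidence_v/and5P[/and4P[_ _ _ /eqP Nkm] _ _ _ _]].
move=> /incidence_v/and5P[/and4P[_ _ _ /eqP Njl] _ _ _ _].
move=> /incidence_v/and5P[/and4P[_ _ _ /eqP Njm] _ _ _ _].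
move=> /incidence_v/and5P[/and4P[_ _ _ /eqP Njk] _ _ _ _].
move=> /andP[/incidence_v/and5P[/and4P[lmc /eqP lmi _ /eqP Nlm] _ _ _ _] _].
have /and5P[/and4P[klc /eqP kli _ /eqP Nkl] _ _ _ _] := incidence_v p5.
have far c : c \in codes 5 -> nth false c i = nth false v i ->
    edge_weight c i <= edge_weight e i -> (c == flip2 v k m) || (c == flip2 v j l).
  move=> cc ci ce; have /implyP := side c cc; rewrite ci eqxx => /(_ isT).
  rewrite !inE => /or4P[/eqP cE|/eqP cE|/eqP cE|/orP[/eqP cE|/or4P[/eqP cE|/eqP cE|->|->]]];
    rewrite ?orbT //; exfalso; move: ce; rewrite cE /edge_weight ?NNv ?Njm ?Njk addrC.
  - by move=> ce; case/negP: vb; apply: min_good; rewrite // /edge_weight addrC.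
  - by move=> ce; case/negP: vb; apply: min_good.
  - by move=> ce; case/negP: klb; apply: min_good; rewrite // /edge_weight addrC.
  - by move=> ce; case/negP: klb; apply: min_good; rewrite // /edge_weight Nkl.
  - by move=> ce; case/negP: lmb; apply: min_good; rewrite // /edge_weight addrC.
  - by move=> ce; case/negP: lmb; apply: min_good; rewrite // /edge_weight Nlm.
have eE := far e ec ei (lexx _).
have [c cc /and4P[/eqP ci c1 c2 ce]] := trop ec i5.
have := far c cc (etrans ci ei) ce.
by case/orP: eE c1 c2 => /eqP->; rewrite ?Nkm ?Njl => /negbTE-> /negbTE->.
Qed.

Definition bad_count v := count (fun i => ~~ good v i) (iota 0 5).

Lemma bad_countE : bad_count v =
  (~~ good v i + (~~ good v j + (~~ good v k + (~~ good v l + (~~ good v m + 0)))))%N.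
Proof.
by move: p5; rewrite mem_permutations => /seq.permP e; rewrite /bad_count -e.
Qed.

End Directions.

(** The directions i and j become good. By [good_transfer], used also with k and l exchanged, u has
    no more bad edges than v in the directions k and l. Only m can be lost, so the count drops. *)
Lemma fewer_bad v i j k l m : v \in codes 5 -> [:: i; j; k; l; m] \in perms5 ->
  ~~ good v i -> ~~ good v j -> good (flip2 v k l) i -> good (flip2 v k l) j ->
  flip2 v k l \in codes 5 /\ (bad_count (flip2 v k l) < bad_count v)%N.
Proof.
move=> vc p5 vi vj ui uj; split.
  by have /and5P[/and4P[]] := incidence_v vc p5.
have p5' : [:: i; j; l; k; m] \in perms5.
  have : all (fun p => if p is [:: i; j; k; l; m] then [:: i; j; l; k; m] \in perms5
    else false) perms5 by clear; vm_compute.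
  by move/allP/(_ _ p5).
have lk : flip2 v l k = flip2 v k l.
  by apply: eq_mkseq => t; rewrite -!addbA [(t == l) (+) _]addbC.
have := good_transfer vc p5' vi vj; rewrite lk => /(_ ui uj) gl.
have gk := good_transfer vc p5 vi vj ui uj.
rewrite (bad_countE (flip2 v k l) p5) (bad_countE v p5) ui uj vi vj.
move: gk gl; case: (good v k); case: (good v l); case: (good _ k); case: (good _ l) => // gk gl;
  by [have := gk isT | have := gl isT | do 2! case: (good _ m)].
Qed.

Lemma exists_few_bad : exists2 v, v \in codes 5 & forall i j, (i < 5)%N -> (j < 5)%N ->
  i != j -> good v i || good v j.
Proof.
have [//|v vc vmin] := @seq_argmin R _ (fun v => (bad_count v)%:R) (codes 5).
exists v => // i j i5 j5 ij; apply/negPn/negP; rewrite negb_or => /andP[vi vj].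
have : all (fun i => all (fun j => (i != j) ==>
    if [seq t <- iota 0 5 | (t != i) && (t != j)] is [:: k; l; m] then
      all (mem perms5) [:: [:: i; j; k; l; m]; [:: i; j; l; m; k]; [:: i; j; m; k; l];
                           [:: j; i; k; l; m]; [:: j; i; l; m; k]; [:: j; i; m; k; l]]
    else false) (iota 0 5)) (iota 0 5) by clear; vm_compute.
move=> /allP/(_ i); rewrite mem_iota => /(_ i5)/allP/(_ j); rewrite mem_iota => /(_ j5).
rewrite ij implyTb; case: [seq t <- _ | _] => [|k [|l [|m []]]] //.
case/and5P=> p1 p2 p3 p4 /and3P[p5 p6 _].
have no_common l' m' k' : [:: i; j; l'; m'; k'] \in perms5 ->
    ~~ (good (flip2 v l' m') i && good (flip2 v l' m') j).
  move=> p; apply/negP => /andP[ui uj].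
  have [uc lt_u] := fewer_bad vc p vi vj ui uj.
  by have := vmin _ uc; rewrite ler_nat leqNgt lt_u.
(* By [good_choice], at least two of [flip2 v k l], [flip2 v l m], [flip2 v m k] are good at i, and
   two at j; so one of them is good at both, against [no_common]. *)
have := (no_common _ _ _ p1, no_common _ _ _ p2, no_common _ _ _ p3).
move: (good_choice vc p1 vi) (good_choice vc p2 vi) (good_choice vc p3 vi).
move: (good_choice vc p4 vj) (good_choice vc p5 vj) (good_choice vc p6 vj).
move: (good (flip2 v k l) i) (good (flip2 v k l) j) (good (flip2 v l m) i).
move: (good (flip2 v l m) j) (good (flip2 v m k) i) (good (flip2 v m k) j).
by do 6! case => //=; move=> *; intuition.
Qed.

End FewBadEdges.
(** * The ten quadrics for n = 5 *)

(* The point [[5]] of the chart [q_[5] = 1] is [full]; [drop2 i j] and [single i]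
   index the entries X_ij and the five 4x4 sub-Pfaffians. *)
Definition full : bitseq := nseq 5 true.
Definition drop2 (i j : nat) : bitseq := mkseq (fun l => (l != i) && (l != j)) 5.
Definition single (i : nat) : bitseq := mkseq (fun l => l == i) 5.

(** With q_full = 1, the side [true] is the expansion of the Pfaffian on the four indices other than
    i. The side [false] says that row i of X is orthogonal to the signed vector of 4x4
    sub-Pfaffians; the test [j < i] accounts for X_ij = - X_ji. *)
Definition facet (i : nat) (s : bool) : seq (bool * (bitseq * bitseq)) :=
  let others := [seq j <- iota 0 5 | j != i] in
  if s then
    if others is [:: a; b; c; d] then
      [:: (false, (full, single i)); (true, (drop2 a b, drop2 c d));
          (false, (drop2 a c, drop2 b d)); (true, (drop2 a d, drop2 b c))]
    else [::]
  else [seq (odd j (+) (j < i)%N, (drop2 i j, single j)) | j <- others].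

Definition quadric (k : fieldType) (y : bitseq -> k) (i : nat) (s : bool) : k :=
  \sum_(e <- facet i s) (-1) ^+ nat_of_bool e.1 * (y e.2.1 * y e.2.2).

Definition rest (i : nat) (c : bitseq) :=
  [seq e <- facet i (nth false c i) | (e.2.1 != c) && (e.2.2 != c)].

Definition edge_sign (i : nat) (c : bitseq) : bool :=
  has (fun e => e.1 && ((e.2.1 == c) || (e.2.2 == c))) (facet i (nth false c i)).

Definition contains_edge (s : seq (bool * (bitseq * bitseq))) i c
    (r : seq (bool * (bitseq * bitseq))) : bool :=
  perm_eq s ((edge_sign i c, (c, neighbor c i)) :: r) ||
  perm_eq s ((edge_sign i c, (neighbor c i, c)) :: r).

Lemma facet_rest : all (fun c => all (fun i =>
  contains_edge (facet i (nth false c i)) i c (rest i c)) (iota 0 5)) (codes 5).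
Proof. by vm_compute. Qed.

Lemma rest_rest : all (fun v => all (fun i => all (fun a =>
  [&& nth false a i == nth false v i, a != v & a != neighbor v i] ==>
  contains_edge (rest i v) i a
    [seq e <- rest i v | (e.2.1 != a) && (e.2.2 != a)])
  (codes 5)) (iota 0 5)) (codes 5).
Proof. by vm_compute. Qed.

Lemma rest_edges : all (fun c => all (fun i => all (fun e =>
  [&& e.2.1 \in codes 5, nth false e.2.1 i == nth false c i, e.2.1 != c,
      e.2.1 != neighbor c i & e.2.2 == neighbor e.2.1 i]) (rest i c)) (iota 0 5)) (codes 5).
Proof. by vm_compute. Qed.

Definition flip (m : bitseq) (i : nat) := mkseq (fun l => nth false m l (+) (l == i)) 5.

Section Quadrics.
Variables (k : fieldType) (y : bitseq -> k).

Let edges_sum (s : seq (bool * (bitseq * bitseq))) :=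
  \sum_(e <- s) (-1) ^+ nat_of_bool e.1 * (y e.2.1 * y e.2.2).

Lemma contains_edge_sum s i c r : contains_edge s i c r ->
  edges_sum s = (-1) ^+ nat_of_bool (edge_sign i c) * (y c * y (neighbor c i)) + edges_sum r.
Proof.
move=> /orP[] /(perm_big _) sE; rewrite /edges_sum sE big_cons //=.
by rewrite [y c * _]mulrC.
Qed.

Lemma quadric_split c i : c \in codes 5 -> (i < 5)%N ->
  quadric y i (nth false c i) =
  (-1) ^+ nat_of_bool (edge_sign i c) * (y c * y (neighbor c i)) + edges_sum (rest i c).
Proof.
move=> cc i5; apply: contains_edge_sum.
by have /allP/(_ c cc)/allP/(_ i) := facet_rest; rewrite mem_iota; apply.
Qed.

(** The signs for which the five products in [syzygy] cancel: a linear syzygy of the quadrics for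
    each of the sixteen subsets [m] of even size. *)
Definition syzygy_sign (m : bitseq) (j : nat) : bool :=
  let b := nth false m in
  nth false [:: false; ~~ (b 0%N (+) b 1%N); b 0%N (+) b 1%N; ~~ b 4%N; b 4%N] j.

Lemma syzygy m : size m = 5 -> ~~ odd (count id m) ->
  \sum_(j <- iota 0 5) (-1) ^+ nat_of_bool (syzygy_sign m j) *
    (y (flip m j) * quadric y j (nth false m j)) = 0.
Proof.
case: m => [|a [|b [|c [|d [|e []]]]]] // _.
by case: a; case: b; case: c; case: d; case: e => // _;
  rewrite /quadric !unlock /=; ring.
Qed.

End Quadrics.

(** * Charts for n = 5 *)

Definition entry0 (v : bitseq) (i : nat) : entry :=
  (neighbor v i, ([:: v],
    [seq (~~ (edge_sign i v (+) e.1), [:: e.2.1; e.2.2]) | e <- rest i v])).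

(** The five neighbors of [v] are dependent, each solved from the quadric of its direction; the
    other 11 coordinates are free. *)
Definition chart0 (v : bitseq) : seq entry := [seq entry0 v i | i <- iota 0 5].

(* Used when the only bad edge at [v] has direction [i]: the quadric [facet i] is
   solved for [a], and this value is substituted in the quadrics at [v] that contain [a]. *)
Definition entry1 (v : bitseq) (i : nat) (a : bitseq) (t : nat) : entry :=
  if nth false a t == nth false v t then
    let b := neighbor a i in
    (neighbor v t, ([:: b; v],
      [seq (~~ (edge_sign t v (+) e.1), [:: b; e.2.1; e.2.2])
         | e <- rest t v & (e.2.1 != a) && (e.2.2 != a)] ++
      [seq (edge_sign t v (+) edge_sign t a (+) edge_sign i a (+) e.1,
            [:: neighbor a t; e.2.1; e.2.2]) | e <- rest i a]))
  else entry0 v t.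

Definition solved_entry (i : nat) (a : bitseq) : entry :=
  let b := neighbor a i in
  (a, ([:: b], [seq (~~ (edge_sign i a (+) e.1), [:: e.2.1; e.2.2]) | e <- rest i a])).

(** Here [a] replaces the neighbor of [v] in direction [i] among the dependent coordinates, and that
    neighbor becomes free. *)
Definition chart1 (v : bitseq) (i : nat) (a : bitseq) : seq entry :=
  solved_entry i a :: [seq entry1 v i a t | t <- iota 0 5 & t != i].

Lemma chart0_wf : all (fun v => wf_chart 5 v (chart0 v)) (codes 5).
Proof. by vm_compute. Qed.

Lemma chart1_wf : all (fun v => all (fun i => all (fun a =>
  [&& nth false a i == nth false v i, a != v & a != neighbor v i] ==>
  wf_chart 5 v (chart1 v i a)) (codes 5)) (iota 0 5)) (codes 5).
Proof. by vm_compute. Qed.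

Section ChartRelations.
Variables (k : fieldType) (y : bitseq -> k).

Local Notation sg b := ((-1) ^+ nat_of_bool b : k).
Local Notation edges_sum s := (\sum_(e <- s) sg e.1 * (y e.2.1 * y e.2.2)).

Lemma edge_terms (s : bool) (pre : seq bitseq) (r : seq (bool * (bitseq * bitseq))) :
  \sum_(t <- [seq (s (+) e.1, pre ++ [:: e.2.1; e.2.2]) | e <- r])
     sg t.1 * \prod_(b <- t.2) y b =
  sg s * \prod_(b <- pre) y b * edges_sum r.
Proof.
rewrite big_map mulr_sumr; apply: eq_bigr => e _ /=.
by rewrite big_cat /= !big_cons big_nil mulr1 signr_addb; ring.
Qed.

Lemma entry0_quadric v i : v \in codes 5 -> (i < 5)%N ->
  (entry_rel y (entry0 v i) <-> quadric y i (nth false v i) = 0).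
Proof.
move=> vc i5; rewrite (quadric_split y vc i5) /entry_rel /= !big_cons big_nil mulr1.
have -> : [seq (~~ (edge_sign i v (+) e.1), [:: e.2.1; e.2.2]) | e <- rest i v] =
    [seq (~~ edge_sign i v (+) e.1, [::] ++ [:: e.2.1; e.2.2]) | e <- rest i v].
  by apply: eq_map => e /=; rewrite addNb.
rewrite edge_terms big_nil mulr1 signrN mulNr.
case: (edge_sign i v); rewrite ?expr0 ?expr1 ?mul1r ?mulN1r ?opprK.
  by split=> [->|/eqP]; [rewrite addNr|rewrite addrC subr_eq0 => /eqP].
by split=> [->|/eqP]; [rewrite addNr|rewrite addr_eq0 => /eqP].
Qed.

Lemma solved_entry_quadric i a : a \in codes 5 -> (i < 5)%N ->
  (entry_rel y (solved_entry i a) <-> quadric y i (nth false a i) = 0).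
Proof.
move=> ac i5; rewrite -entry0_quadric // /entry_rel /= !big_cons !big_nil !mulr1.
by rewrite mulrC.
Qed.

(** If a occurs in the quadric of direction t, the entry is this quadric times q_b, where b =
    [neighbor a i], with q_a q_b eliminated through the quadric of direction i. The multiplication
    is reversible when q_b is nonzero. *)
Lemma entry1_quadric v i a t : v \in codes 5 -> (i < 5)%N -> a \in codes 5 -> (t < 5)%N ->
    nth false a i == nth false v i -> a != v -> a != neighbor v t ->
    quadric y i (nth false a i) = 0 ->
  (quadric y t (nth false v t) = 0 -> entry_rel y (entry1 v i a t)) /\
  (y (neighbor a i) != 0 -> entry_rel y (entry1 v i a t) ->
   quadric y t (nth false v t) = 0).
Proof.
move=> vc i5 ac t5 ai av aNv; rewrite (quadric_split y ac i5) => qi.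
rewrite /entry1; case: ifP => [at_|_]; last first.
  by have [e0 q0] := entry0_quadric vc t5; split=> // _.
have /(contains_edge_sum y) restE : contains_edge (rest t v) t a
    [seq e <- rest t v | (e.2.1 != a) && (e.2.2 != a)].
  have /allP/(_ v vc)/allP/(_ t) := rest_rest; rewrite mem_iota => /(_ t5).
  by move=> /allP/(_ a ac); rewrite at_ av aNv.
rewrite (quadric_split y vc t5) restE /entry_rel /=.
set b := neighbor a i in qi *; set r := [seq e <- rest t v | _].
rewrite big_cat /=.
have -> : [seq (~~ (edge_sign t v (+) e.1), [:: b; e.2.1; e.2.2]) | e <- r] =
    [seq (~~ edge_sign t v (+) e.1, [:: b] ++ [:: e.2.1; e.2.2]) | e <- r].
  by apply: eq_map => e /=; rewrite addNb.
rewrite edge_terms (edge_terms (edge_sign t v (+) edge_sign t a (+) edge_sign i a)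
  [:: neighbor a t] (rest i a)) !big_cons !big_nil !mulr1 !signr_addb signrN.
move: (edges_sum r) (edges_sum (rest i a)) qi => rs ri.
move: (y a) (y b) (y v) (y (neighbor v t)) (y (neighbor a t)) => ya yb yv yvt yat.
have ss (c : bool) : sg c * sg c = 1 by rewrite -signr_addb addbb.
move: (ss (edge_sign i a)) (ss (edge_sign t v)).
move: (sg (edge_sign i a)) (sg (edge_sign t v)) (sg (edge_sign t a)) => si sv st si1 sv1 qi.
have riE : ri = - si * (ya * yb).
  by move/eqP: qi; rewrite addrC addr_eq0 mulNr => /eqP.
(* Up to the sign [sv], q_b times the quadric is the difference of the two sides of the entry; both
   implications follow from this. *)
have id : sv * yb * (sv * (yv * yvt) + (st * (ya * yat) + rs)) =
   yb * yv * yvt - (- sv * yb * rs + sv * st * si * yat * ri).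
  rewrite riE; transitivity ((sv * sv) * (yb * yv * yvt) + sv * yb * rs +
    sv * st * ya * yat * yb); first by ring.
  rewrite sv1; transitivity (yb * yv * yvt + sv * yb * rs +
    (si * si) * (sv * st * ya * yat * yb)); first by rewrite si1; ring.
  by ring.
split=> [q0|b0 e].
  by move: id; rewrite q0 mulr0 => /esym/eqP; rewrite subr_eq0 => /eqP ->; ring.
have sv0 : sv != 0.
  by apply/eqP => sv0; move/eqP: sv1; rewrite sv0 mul0r eq_sym oner_eq0.
by apply: (mulfI (mulf_neq0 sv0 b0)); rewrite mulr0 id e; ring.
Qed.

End ChartRelations.

(** * The cone over the Pfaffian points *)

Section PfaffianCone.
Variables (k : closedFieldType) (n : nat).
Hypothesis char0 : [pchar k] =i pred0.
Hypothesis small_codes : all (fun b => size (zeros b) \in [:: 0; 2; 4]%N) (codes n).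

Lemma pfaffian_point_value (X : 'M[k]_n) : X^T = - X ->
  exists2 x : nat -> nat -> k, (forall i j, x i j = - x j i) &
    forall b, b \in codes n -> pfaffian_point X (code_index n b) = pf_value x (zeros b).
Proof.
move=> Xskew.
pose x i j := if insub i is Some i' then if insub j is Some j' then X i' j' else 0 else 0.
have xskew i j : x i j = - x j i.
  rewrite /x; case: insubP => [i' _ _|_]; case: insubP => [j' _ _|_]; rewrite ?oppr0 //.
  by have := congr1 (fun M : 'M_n => M j' i') Xskew; rewrite !mxE.
exists x => // b bc; apply: pfaffian_code => //.
- by move=> i j; rewrite /x !valK.
- by rewrite -mem_codes.
- exact: (allP small_codes).
Qed.

(** The skew-symmetric matrix read off from a point: above the diagonal, the coordinate of the
    complement of {i, j} divided by that of [n]. *)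
Definition affine_entry (y : bitseq -> k) (i j : nat) : k :=
  let z i j := y (mkseq (fun l => (l != i) && (l != j)) n) / y (nseq n true) in
  if (i < j)%N then z i j else if (j < i)%N then - z j i else 0.

Lemma pfaffian_cone (y : bitseq -> k) :
    (forall b, b \in codes n ->
       y b = y (nseq n true) * pf_value (affine_entry y) (zeros b)) ->
  exists (X : 'M[k]_n) (c : k), X^T = - X /\
    forall b, valid n b -> y b = c * pfaffian_point X (code_index n b).
Proof.
move=> yE; have skew i j : affine_entry y i j = - affine_entry y j i.
  by rewrite /affine_entry; case: ltngtP => _; rewrite ?opprK ?oppr0.
exists (\matrix_(i, j) affine_entry y i j), (y (nseq n true)); split.
  by apply/matrixP => i j; rewrite !mxE.
move=> b bv; have bc : b \in codes n by rewrite mem_codes.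
rewrite yE // (pfaffian_code char0 (x := affine_entry y)) //.
  by move=> i j; rewrite mxE.
exact: (allP small_codes).
Qed.

End PfaffianCone.

(** * The case n = 5 *)

Section DimensionFive.
Variables (k : closedFieldType) (R : realType) (w : spinor_index 5 -> R).
Hypothesis char0 : [pchar k] =i pred0.

Lemma small_codes5 : all (fun b => size (zeros b) \in [:: 0; 2; 4]%N) (codes 5).
Proof. by vm_compute. Qed.

Lemma facet_codes : all (fun i => all (fun s => all (fun e =>
  (e.2.1 \in codes 5) && (e.2.2 \in codes 5)) (facet i s)) [:: true; false]) (iota 0 5).
Proof. by vm_compute. Qed.

Lemma neighbor_facts : all (fun c => all (fun i =>
  [&& neighbor c i \in codes 5, neighbor (neighbor c i) i == c &
      nth false (neighbor c i) i == nth false c i]) (iota 0 5)) (codes 5).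
Proof. by vm_compute. Qed.

Lemma quadric_eq (y y' : bitseq -> k) i s : (i < 5)%N ->
  (forall b, b \in codes 5 -> y b = y' b) -> quadric y i s = quadric y' i s.
Proof.
move=> i5 yy'; rewrite /quadric big_seq [RHS]big_seq; apply: eq_bigr => e es.
have /allP/(_ i) := facet_codes; rewrite mem_iota => /(_ i5)/allP/(_ s).
have -> : s \in [:: true; false] by case: s {es}.
by move=> /(_ isT)/allP/(_ e es)/andP[e1 e2]; rewrite !yy'.
Qed.

Lemma quadric_pfaffian (X : 'M[k]_5) i s : X^T = - X -> (i < 5)%N ->
  quadric (fun b => pfaffian_point X (code_index 5 b)) i s = 0.
Proof.
move=> /(pfaffian_point_value char0 small_codes5)[x _ xE] i5.
rewrite (quadric_eq (y' := fun b => pf_value x (zeros b))) // {xE}.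
by case: s; case: i i5 => [|[|[|[|[|[]]]]]] // _; rewrite /quadric unlock /=; ring.
Qed.

Lemma flip_facts : all (fun v => all (fun i =>
  let m := flip v i in
  [&& size m == 5, ~~ odd (count id m), flip m i == v, nth false m i == ~~ nth false v i &
      all (fun j => (j != i) ==> (nth false m j == nth false v j)) (iota 0 5)])
  (iota 0 5)) (codes 5).
Proof. by vm_compute. Qed.

(** If the i-th bit of v is false, all products in the syzygy of [flip v i] except that of direction
    i vanish by hypothesis, and the remaining one is, up to sign, q_v times the wanted quadric. *)
Lemma quadrics_at_full (y : bitseq -> k) v : v \in codes 5 -> y v != 0 ->
    (forall i, (i < 5)%N -> quadric y i (nth false v i) = 0) ->
  forall i, (i < 5)%N -> quadric y i true = 0.
Proof.
move=> vc v0 qv i i5; case vi: (nth false v i); first by rewrite -vi qv.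
have /allP/(_ v vc)/allP/(_ i) := flip_facts; rewrite mem_iota => /(_ i5).
move=> /and5P[/eqP sm pm /eqP mv /eqP mi /allP mj].
have := syzygy y sm pm; rewrite (bigD1_seq i) ?mem_iota ?iota_uniq //= big_seq_cond.
rewrite big1 ?addr0 => [|j /andP[j5 ji]]; last first.
  have /implyP/(_ ji)/eqP-> := mj j j5.
  have {}j5 : (j < 5)%N by move: (j5 : j \in iota 0 5); rewrite mem_iota.
  by rewrite qv // !mulr0.
rewrite mv mi vi => /eqP; rewrite !mulf_eq0 signr_eq0 (negbTE v0) /=.
by move/eqP.
Qed.

(** The quadrics at v imply those at [full], and each of the latter expresses one 4x4 sub-Pfaffian
    through the entries X_ij. *)
Lemma quadrics_cone (y : bitseq -> k) v : v \in codes 5 ->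
    (forall b, valid 5 b -> y b != 0) ->
    (forall i, (i < 5)%N -> quadric y i (nth false v i) = 0) ->
  exists (X : 'M[k]_5) (c : k), X^T = - X /\
    forall b, valid 5 b -> y b = c * pfaffian_point X (code_index 5 b).
Proof.
move=> vc y0 qv; apply: (pfaffian_cone char0 small_codes5).
have v0 : y v != 0 by apply: y0; rewrite -mem_codes.
have q := quadrics_at_full vc v0 qv; have f0 := y0 full isT.
have codesE : codes 5 = full :: [:: drop2 3 4; drop2 2 4; drop2 2 3; drop2 1 4; drop2 1 3;
  drop2 1 2; single 0; drop2 0 4; drop2 0 3; drop2 0 2; single 1; drop2 0 1; single 2;
  single 3; single 4]%N by vm_compute.
move=> b; rewrite codesE !inE.
have entry_ok i j : y (drop2 i j) = y full * (y (drop2 i j) / y full).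
  by rewrite mulrC divfK.
have entryE i j : (i < j)%N -> affine_entry 5 y i j = y (drop2 i j) / y full.
  by rewrite /affine_entry => ->.
have single_ok i (i5 : (i < 5)%N) z : y full * y (single i) - quadric y i true = y full * z ->
    y (single i) = z.
  by rewrite q // subr0 => /(mulfI f0).
do 15 (case/orP=> [/eqP->|]; first do [by rewrite mulr1 | exact: entry_ok |
      by apply: single_ok => //; rewrite /quadric unlock /= !entryE // -[y [:: true, _ & _]]/(y full); field]).
by move/eqP->; apply: single_ok => //; rewrite /quadric unlock /= !entryE // -[y [:: true, _ & _]]/(y full); field.
Qed.

Hypothesis trop : in_trop w (spinor_ideal k 5).
Local Notation W := (fun b => w (code_index 5 b)).
Local Notation conclusion := (smooth (torus_structure (initial_ideal w (spinor_ideal k 5))) /\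
  spec_irreducible (torus_scheme (initial_ideal w (spinor_ideal k 5)))).

Lemma rest_edgeP c i e : c \in codes 5 -> (i < 5)%N -> e \in rest i c ->
  [/\ e.2.1 \in codes 5, nth false e.2.1 i = nth false c i, e.2.1 != c,
      e.2.1 != neighbor c i & e.2.2 = neighbor e.2.1 i].
Proof.
move=> cc i5 er; have /allP/(_ c cc)/allP/(_ i) := rest_edges.
rewrite mem_iota => /(_ i5)/allP/(_ e er).
by move=> /and5P[-> /eqP-> -> -> /eqP->].
Qed.

Lemma trop_edges c i : c \in codes 5 -> (i < 5)%N ->
  exists2 c', c' \in codes 5 & [&& nth false c' i == nth false c i, c' != c,
    c' != neighbor c i & edge_weight W c' i <= edge_weight W c i].
Proof.
move=> cc i5.
have [||t tr tw] := @trop_edge k R 5 w [:: c; neighbor c i] (edge_sign i c)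
  [seq (e.1, [:: e.2.1; e.2.2]) | e <- rest i c] _ _ trop.
- by move=> t /mapP[e _ ->].
- move=> X Xskew /=; rewrite -[RHS](quadric_pfaffian (nth false c i) Xskew i5).
  rewrite (quadric_split _ cc i5) !big_cons big_nil mulr1; congr (_ + _).
  by rewrite big_map; apply: eq_bigr => e _; rewrite !big_cons big_nil mulr1.
move: tr tw => /mapP[e er ->]; rewrite !big_cons !big_nil !addr0.
have [e1c e1i e1 e1n e2] := rest_edgeP cc i5 er.
by rewrite e2 => ew; exists e.2.1 => //; rewrite e1i eqxx e1 e1n.
Qed.

Lemma good_rest v i e : v \in codes 5 -> (i < 5)%N -> good W v i -> e \in rest i v ->
  W v + W (neighbor v i) <= W e.2.1 + W e.2.2.
Proof.
move=> vc i5 /goodP vg er; have [e1c e1i _ _ ->] := rest_edgeP vc i5 er.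
exact: vg.
Qed.

Lemma entry0_weight v i : v \in codes 5 -> (i < 5)%N -> good W v i ->
  entry_weight W (entry0 v i).
Proof.
move=> vc i5 vg t /mapP[e er ->]; rewrite !big_cons !big_nil !addr0.
exact: good_rest er.
Qed.

Lemma all_good_smooth_irreducible v : v \in codes 5 ->
  (forall i, (i < 5)%N -> good W v i) -> conclusion.
Proof.
move=> vc vg; apply: (@code_chart k R 5 w v (chart0 v)) trop.
- exact: (allP chart0_wf).
- move=> X e Xskew /mapP[i]; rewrite mem_iota => i5 ->.
  by apply/entry0_quadric => //; apply: quadric_pfaffian.
- move=> y y0 yC; apply: (quadrics_cone vc y0) => i i5.
  by apply/entry0_quadric => //; apply/yC/map_f; rewrite mem_iota.
- move=> e /mapP[i]; rewrite mem_iota => i5 ->.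
  by apply: entry0_weight => //; apply: vg.
Qed.

Lemma one_bad_smooth_irreducible v i : v \in codes 5 -> (i < 5)%N -> ~~ good W v i ->
  (forall t, (t < 5)%N -> t != i -> good W v t) -> conclusion.
Proof.
move=> vc i5 vi vt.
(* [a] lies on a lightest edge of the quadric of direction [i] at [v]; as [v] is bad there, this is
   not the edge of [v]. *)
have [|a + amin] := @seq_argmin R _ (edge_weight W ^~ i)
    [seq c <- codes 5 | nth false c i == nth false v i].
  by rewrite -has_filter; apply/hasP; exists v.
rewrite mem_filter => /andP[/eqP ai ac].
have ag : good W a i.
  by apply/goodP => c cc ci; apply: amin; rewrite mem_filter cc ci ai eqxx.
have neighbor_side c t : c \in codes 5 -> (t < 5)%N ->
    [/\ neighbor c t \in codes 5, neighbor (neighbor c t) t = c &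
        nth false (neighbor c t) t = nth false c t].
  move=> cc t5; have /allP/(_ c cc)/allP/(_ t) := neighbor_facts.
  by rewrite mem_iota => /(_ t5)/and3P[-> /eqP-> /eqP->].
have [Nvc NNv Nvi] := neighbor_side v i vc i5.
have [Nac NNa Nai] := neighbor_side a i ac i5.
have av : a != v by apply: contraNneq vi => <-.
have aNv : a != neighbor v i.
  apply: contraNneq vi => aE; apply/goodP => c cc ci.
  have := goodP _ _ _ ag c cc; rewrite ai => /(_ ci).
  by rewrite aE /edge_weight NNv addrC.
have aNvt t : (t < 5)%N -> t != i -> a != neighbor v t.
  move=> t5 ti; apply: contraTneq isT => aE.
  have : nth false a i != nth false v i; last by rewrite ai eqxx.
  by rewrite aE nth_mkseq // [i == t]eq_sym ti addbT; case: nth.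
have wf : wf_chart 5 v (chart1 v i a).
  have /allP/(_ v vc)/allP/(_ i) := chart1_wf; rewrite mem_iota => /(_ i5)/allP/(_ a ac).
  by rewrite ai eqxx av aNv.
have chartP e : e \in chart1 v i a -> e = solved_entry i a \/
    exists t, [/\ (t < 5)%N, t != i & e = entry1 v i a t].
  rewrite inE => /orP[/eqP->|/mapP[t]]; first by left.
  by rewrite mem_filter mem_iota => /andP[ti t5] ->; right; exists t.
apply: (@code_chart k R 5 w v (chart1 v i a) wf) trop.
- move=> X e Xskew /chartP[->|[t [t5 ti ->]]].
    by apply/solved_entry_quadric => //; apply: quadric_pfaffian.
  have [|+ _] := entry1_quadric (y := fun b => pfaffian_point X (code_index 5 b)) vc i5 ac t5 (introT eqP ai) av (aNvt t t5 ti).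
    exact: quadric_pfaffian.
  by apply; apply: quadric_pfaffian.
- move=> y y0 yC; apply: (quadrics_cone vc y0).
  have qi : quadric y i (nth false a i) = 0.
    by apply/solved_entry_quadric => //; apply: yC; rewrite mem_head.
  move=> t t5; have [->|ti] := eqVneq t i; first by rewrite -ai.
  have [_] := entry1_quadric vc i5 ac t5 (introT eqP ai) av (aNvt t t5 ti) qi.
  apply; first by apply: y0; rewrite -mem_codes.
  by apply: yC; rewrite inE map_f ?orbT // mem_filter ti mem_iota.
move=> e /chartP[-> t /mapP[e' er ->]|[t [t5 ti ->]]].
  rewrite !big_cons !big_nil !addr0 addrC; exact: good_rest er.
rewrite /entry1; case: ifP => [/eqP at_|_]; last by apply: entry0_weight => //; apply: vt.
have vg := vt t t5 ti.
move=> u; rewrite mem_cat => /orP[] /mapP[e' er ->]; rewrite !big_cons !big_nil !addr0.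
  move: er; rewrite mem_filter => /andP[_ er].
  by rewrite -addrA lerD2l; apply: good_rest er.
(* Goodness of [v] at t bounds its edge by that of [a] in direction t, and goodness of [a] at i
   bounds the edge of [a] by the terms replacing it; adding the two, the weight of [a] cancels. *)
have := good_rest ac i5 ag er; have := goodP _ _ _ vg a ac at_.
rewrite /edge_weight; lra.
Qed.

Lemma spinor5_smooth_irreducible : conclusion.
Proof.
have [v vc few] := exists_few_bad trop_edges.
have [/allP vg|] := boolP (all (good W v) (iota 0 5)).
  by apply: (all_good_smooth_irreducible vc) => i i5; apply: vg; rewrite mem_iota.
rewrite -has_predC => /hasP[i /[!mem_iota] i5 vi].
apply: (one_bad_smooth_irreducible vc i5 vi) => t t5 ti.
by have := few i t i5 t5; rewrite eq_sym ti (negbTE vi); apply.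
Qed.

End DimensionFive.
(** * The cases n < 5 *)

Section DimensionFour.
Variables (k : closedFieldType) (R : realType) (w : spinor_index 4 -> R).
Hypothesis char0 : [pchar k] =i pred0.
Hypothesis trop : in_trop w (spinor_ideal k 4).
Local Notation W := (fun b => w (code_index 4 b)).

Definition pair4 (i j : nat) : bitseq := mkseq (fun l => (l != i) && (l != j)) 4.

(** The expansion of the 4x4 Pfaffian, the only quadric for n = 4. *)
Definition facet4 : seq (bool * (bitseq * bitseq)) :=
  [:: (false, (nseq 4 true, nseq 4 false)); (true, (pair4 0 1, pair4 2 3));
      (false, (pair4 0 2, pair4 1 3)); (true, (pair4 0 3, pair4 1 2))].

Definition entry4 (e : bool * (bitseq * bitseq)) : entry :=
  (e.2.2, ([:: e.2.1],
    [seq (~~ (e.1 (+) e'.1), [:: e'.2.1; e'.2.2]) | e' <- rem e facet4])).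

Lemma entry4_wf : all (fun e => wf_chart 4 e.2.1 [:: entry4 e]) facet4.
Proof. by vm_compute. Qed.

Lemma entry4_quadric (y : bitseq -> k) e : e \in facet4 ->
  entry_rel y (entry4 e) <->
  \sum_(e <- facet4) (-1) ^+ nat_of_bool e.1 * (y e.2.1 * y e.2.2) = 0.
Proof.
move=> ef; rewrite (big_rem e ef) /entry_rel /=.
have -> : [seq (~~ (e.1 (+) e'.1), [:: e'.2.1; e'.2.2]) | e' <- rem e facet4] =
    [seq (~~ e.1 (+) e'.1, [::] ++ [:: e'.2.1; e'.2.2]) | e' <- rem e facet4].
  by apply: eq_map => e' /=; rewrite addNb.
rewrite edge_terms big_seq1 big_nil mulr1 signrN mulNr.
case: e.1; rewrite ?expr0 ?expr1 ?mul1r ?mulN1r ?opprK.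
  by split=> [->|/eqP]; [rewrite addNr|rewrite addrC subr_eq0 => /eqP].
by split=> [->|/eqP]; [rewrite addNr|rewrite addr_eq0 => /eqP].
Qed.

Lemma small_codes4 : all (fun b => size (zeros b) \in [:: 0; 2; 4]%N) (codes 4).
Proof. by vm_compute. Qed.

Lemma spinor4_smooth_irreducible :
  smooth (torus_structure (initial_ideal w (spinor_ideal k 4))) /\
  spec_irreducible (torus_scheme (initial_ideal w (spinor_ideal k 4))).
Proof.
(* A lightest monomial of the quadric can always be solved for one of its variables, so a chart
   without bad edges exists. *)
have [//|e ef emin] := @seq_argmin R _ (fun e => W e.2.1 + W e.2.2) facet4.
apply: (@code_chart k R 4 w e.2.1 [:: entry4 e]) trop.
- exact: (allP entry4_wf).
- move=> X e' Xskew /[!inE] /eqP->; apply/entry4_quadric => //.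
  have [x _ xE] := pfaffian_point_value char0 small_codes4 Xskew.
  by rewrite unlock /= !xE //= /pf_value /=; ring.
- move=> y y0 /(_ _ (mem_head _ _))/(entry4_quadric _ ef).
  rewrite unlock /= => yq; apply: (pfaffian_cone char0 small_codes4).
  set f := nseq 4 true; have f0 : y f != 0 by apply: y0.
  have codesE : codes 4 = [:: f; pair4 2 3; pair4 1 3; pair4 1 2; pair4 0 3;
    pair4 0 2; pair4 0 1; nseq 4 false]%N by vm_compute.
  have entryE i j : (i < j)%N -> affine_entry 4 y i j = y (pair4 i j) / y f.
    by rewrite /affine_entry => ->.
  move=> b; rewrite codesE !inE.
  do 7 (case/orP=> [/eqP->|]; first
    by rewrite ?mulr1 // /= ?entryE // mulrC divfK).
  move=> /eqP->; apply: (mulfI f0); rewrite -[LHS]subr0 -yq /= !entryE //.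
  by field.
move=> e' /[!inE] /eqP-> t /mapP[u uf ->]; rewrite !big_cons !big_nil !addr0.
by apply: emin; apply: mem_rem uf.
Qed.

End DimensionFour.

(** For n at most 3 the Pfaffians are 1 and entries of X, so every torus point lies on the cone and
    the chart without relations applies. *)
Lemma spinor_small_smooth_irreducible (k : closedFieldType) (R : realType) (n : nat)
    (w : spinor_index n -> R) : [pchar k] =i pred0 -> (0 < n <= 3)%N ->
    in_trop w (spinor_ideal k n) ->
  smooth (torus_structure (initial_ideal w (spinor_ideal k n))) /\
  spec_irreducible (torus_scheme (initial_ideal w (spinor_ideal k n))).
Proof.
move=> char0 n3 trop; apply: (@code_chart k R n w (nseq n true) [::]) trop => //.
  by case: n n3 {w} => [|[|[|[|]]]].
move=> y y0 _; have f0 : y (nseq n true) != 0.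
  by apply: y0; rewrite /valid size_nseq eqxx count_nseq mul1n subnn.
apply: (pfaffian_cone char0); first by case: n n3 {w y y0 f0} => [|[|[|[|]]]].
have entryE i j : (i < j)%N -> affine_entry n y i j =
    y (mkseq (fun l => (l != i) && (l != j)) n) / y (nseq n true).
  by rewrite /affine_entry => ->.
move=> b; case: n n3 y y0 f0 entryE {w} => [|[|[|[|]]]] // _ y _ f0 entryE.
- have -> : codes 1 = [:: nseq 1 true] by vm_compute.
  by rewrite !inE => /eqP->; rewrite mulr1.
- have -> : codes 2 = [:: nseq 2 true; nseq 2 false] by vm_compute.
  rewrite !inE => /orP[] /eqP->; first by rewrite mulr1.
  by rewrite /= entryE // mulrC divfK.
have -> : codes 3 = nseq 3 true :: [seq mkseq (fun l => (l != p.1) && (l != p.2)) 3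
    | p <- [:: (1, 2); (0, 2); (0, 1)]]%N by vm_compute.
rewrite !inE => /or4P[] /eqP->; first by rewrite mulr1.
- by rewrite /= entryE // mulrC divfK.
- by rewrite /= entryE // mulrC divfK.
by rewrite /= entryE // mulrC divfK.
Qed.

Theorem theorem1p2 (k : closedFieldType) (char0 : [pchar k] =i pred0)
    (R : realType) (n : nat) (n_gt0 : (0 < n)%N) (n_le5 : (n <= 5)%N)
    (w : spinor_index n -> R) :
  in_trop w (spinor_ideal k n) ->
  smooth (torus_structure (initial_ideal w (spinor_ideal k n))) /\
  spec_irreducible (torus_scheme (initial_ideal w (spinor_ideal k n))).
Proof.
move=> trop; have [n3|n3] := leqP n 3.
  by apply: spinor_small_smooth_irreducible; rewrite ?n_gt0.
case: n n_gt0 n_le5 n3 w trop => [|[|[|[|[|[|]]]]]] // _ _ _ w trop.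
  exact: spinor4_smooth_irreducible.
exact: spinor5_smooth_irreducible.
Qed.
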